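(* Consider sufficiently smooth fields satisfying, in a bounded control volume $V\subset\mathbb{R}^3$ with piecewise smooth boundary and outward unit normal $\boldsymbol{n}$, the mixture entropy balance $$\frac{\partial (\rho s)}{\partial t}+\nabla\cdot(\rho s\,\boldsymbol{u})=\frac{\alpha_1\overline{\overline{\tau}}_1:\overline{\overline{D}}_1}{T_1}+\frac{\alpha_2\overline{\overline{\tau}}_2:\overline{\overline{D}}_2}{T_2}+\frac{\mathcal{Q}_1+q_1+\mathcal{I}_1}{T_1}+\frac{\mathcal{Q}_2+q_2+\mathcal{I}_2}{T_2}$$ of the reduced two-phase five-equation model, with $\overline{\overline{\tau}}_k,\overline{\overline{D}}_k,\mathcal{Q}_k,q_k,\mathcal{I}_k$ as defined in the context. Suppose there is no heat flow through the boundary of the control volume, i.e. $\alpha_k\lambda_k\nabla T_k\cdot\boldsymbol{n}=0$ on $\partial V$ for $k=1,2$. Then the total entropy production in $V$ is non-negative: $$\int_V\left[\frac{\partial(\rho s)}{\partial t}+\nabla\cdot(\rho s\,\boldsymbol{u})\right]d\tau=\int_V\sum_{k=1}^{2}\frac{\alpha_k\overline{\overline{\tau}}_k:\overline{\overline{D}}_k+\mathcal{Q}_k+q_k+\mathcal{I}_k}{T_k}\,d\tau\;\ge\;0 .$$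
   Context: The reduced five-equation model describes a two-phase compressible flow (phases $k=1,2$) with a common velocity $\boldsymbol{u}$ and a common pressure $p$, but with two phase temperatures; it is obtained from the Baer-Nunziato model in the limit of instantaneous velocity and pressure relaxation. The fields are functions of $(x,t)$. Notation: $\alpha_k\ge 0$ is the volume fraction, $\alpha_1+\alpha_2=1$; $\rho_k>0$ the phase density; $T_k>0$ the phase absolute temperature; $s_k$ the phase specific entropy; $\rho=\alpha_1\rho_1+\alpha_2\rho_2$ the mixture density; $Y_k=\alpha_k\rho_k/\rho$ the mass fraction; $s=Y_1s_1+Y_2s_2$ the mixture entropy. Strain rate: $\overline{\overline{D}}_k=\frac12\left[\nabla\boldsymbol{u}_k+(\nabla\boldsymbol{u}_k)^{T}\right]$, where $\boldsymbol{u}_1=\boldsymbol{u}_2=\boldsymbol{u}$ in the reduced model. Newtonian viscous stress: $\overline{\overline{\tau}}_k=2\mu_k\overline{\overline{D}}_k+\left(\mu_{b,k}-\frac23\mu_k\right)(\nabla\cdot\boldsymbol{u}_k)\,\overline{\overline{I}}$, with shear viscosity $\mu_k>0$, bulk viscosity $\mu_{b,k}>0$, and $\overline{\overline{I}}$ the unit tensor. The symbol '':'' denotes the full contraction $A:B=\sum_{i,j}A_{ij}B_{ij}$. Temperature relaxation: $\mathcal{Q}_1=\varsigma(T_2-T_1)$, $\mathcal{Q}_2=\varsigma(T_1-T_2)$, with rate $\varsigma>0$. Heat conduction: $q_k=\nabla\cdot(\alpha_k\lambda_k\nabla T_k)$, with thermal conductivity $\lambda_k\ge 0$ (the phase heat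 flux is $-\alpha_k\lambda_k\nabla T_k$). External heat source: $\mathcal{I}_k=\alpha_kI_k$ with intensity $I_k\ge 0$. *)

(* Defs.v *)
From HB Require Import structures.
From mathcomp Require Import all_boot all_order all_algebra.
From mathcomp Require Import all_classical all_reals all_analysis.

Set Implicit Arguments.
Unset Strict Implicit.
Unset Printing Implicit Defensive.

Import Order.TTheory GRing.Theory Num.Theory numFieldNormedType.Exports.

Local Open Scope classical_set_scope.
Local Open Scope ring_scope.

Section Calculus.
Variable R : realType.
Local Notation space := 'rV[R]_3.

Definition basis_vec (i : 'I_3) : space := delta_mx 0 i.

(* The norm that the library puts on row vectors is the sup norm; Euclidean
   lengths are taken with [dot]. *)
Definition dot (a b : space) : R := \sum_i a 0 i * b 0 i.

Definition contraction (A B : 'M[R]_3) : R := \sum_i \sum_j A i j * B i j.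

Definition grad (f : space -> R) (x : space) : space :=
  \row_i 'D_(basis_vec i) f x.

(* The library's Jacobian acts on row vectors from the right, so that
   ('J G x) i j is the i-th partial derivative of G_j. *)
Definition divergence (G : space -> space) (x : space) : R := \tr ('J G x).

Definition C1_on (U : normedModType R) (W : set space) (f : space -> U) : Prop :=
  forall x, W x ->
    differentiable f x /\ forall i, {for x, continuous ('D_(basis_vec i) f)}.

Definition C2_on (W : set space) (f : space -> R) : Prop :=
  C1_on W f /\ forall i, C1_on W ('D_(basis_vec i) f).

Definition C1_curve (c : R -> space) : Prop :=
  (forall r, derivable c r 1) /\ continuous (derive1 c).

Definition boundary (V : set space) : set space := closure V `\` V°.

(* Near x the set V is the strict sublevel set {phi < 0} of a C^1 function with
   nonzero gradient at the boundary point x, so the boundary of V is a C^1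
   surface there with V on one side only, and grad phi points out of V. *)
Definition outward_unit_normal (V : set space) (x nu : space) : Prop :=
  exists (U : set space) (phi : space -> R),
    [/\ open U, U x, C1_on U phi & forall y, U y -> (V y <-> phi y < 0)] /\
    [/\ phi x = 0, grad phi x != 0 &
        nu = (Num.sqrt (dot (grad phi x) (grad phi x)))^-1 *: grad phi x].

(* The boundary is a C^1 surface except at edges and vertices, which lie on
   finitely many compact C^1 arcs; a constant arc accounts for an isolated
   vertex such as the apex of a cone. *)
Definition piecewise_smooth_boundary (V : set space) : Prop :=
  exists (m : nat) (c : 'I_m -> R -> space),
    (forall j, C1_curve (c j)) /\
    forall x, boundary V x ->
      (exists nu, outward_unit_normal V x nu) \/
      (exists j, (c j @` `[0, 1]) x).

(* Row vectors carry no measurable structure in the library: volume integrals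
   are taken on R * R * R with the product Lebesgue measure. *)
Definition of_coords (p : R * R * R) : space :=
  \row_i [:: p.1.1; p.1.2; p.2]`_i.

Definition volume :=
  ((@lebesgue_measure R \x @lebesgue_measure R) \x @lebesgue_measure R)%E.

Definition volume_integral (V : set space) (f : space -> R) : \bar R :=
  (\int[volume]_(p in of_coords @^-1` V) (f (of_coords p))%:E)%E.

Definition volume_integrable (V : set space) (f : space -> R) : Prop :=
  volume.-integrable (of_coords @^-1` V) (fun p => (f (of_coords p))%:E).

End Calculus.

(* Fields take the time first. Phases are indexed by 'I_2, and the phase other
   than k is [rev_ord k]. *)
Record two_phase_flow (R : realType) := TwoPhaseFlow {
  alpha : 'I_2 -> R -> 'rV[R]_3 -> R;      (* volume fraction *)
  density : 'I_2 -> R -> 'rV[R]_3 -> R;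
  temp : 'I_2 -> R -> 'rV[R]_3 -> R;       (* absolute temperature *)
  entropy : 'I_2 -> R -> 'rV[R]_3 -> R;    (* specific entropy *)
  velocity : R -> 'rV[R]_3 -> 'rV[R]_3;    (* common to both phases *)
  shear_visc : 'I_2 -> R -> 'rV[R]_3 -> R;
  bulk_visc : 'I_2 -> R -> 'rV[R]_3 -> R;
  conductivity : 'I_2 -> R -> 'rV[R]_3 -> R;
  heat_intensity : 'I_2 -> R -> 'rV[R]_3 -> R;  (* external heat source *)
  relax_rate : R -> 'rV[R]_3 -> R          (* temperature relaxation *)
}.

Section Model.
Variables (R : realType) (F : two_phase_flow R).
Implicit Types (k : 'I_2) (t : R) (x : 'rV[R]_3).

Definition mix_density t x : R := \sum_k alpha F k t x * density F k t x.

Definition mass_fraction k t x : R :=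
  alpha F k t x * density F k t x / mix_density t x.

Definition mix_entropy t x : R := \sum_k mass_fraction k t x * entropy F k t x.

Definition entropy_density t x : R := mix_density t x * mix_entropy t x.

Definition strain_rate t x : 'M[R]_3 :=
  2^-1 *: ('J (velocity F t) x + ('J (velocity F t) x)^T).

Definition viscous_stress k t x : 'M[R]_3 :=
  (2 * shear_visc F k t x) *: strain_rate t x
  + ((bulk_visc F k t x - 2 / 3 * shear_visc F k t x)
     * divergence (velocity F t) x)%:M.

Definition viscous_power k t x : R :=
  alpha F k t x * contraction (viscous_stress k t x) (strain_rate t x).

Definition heat_exchange k t x : R :=
  relax_rate F t x * (temp F (rev_ord k) t x - temp F k t x).

(* The phase heat flux is the opposite of this vector. *)
Definition conduction_vec k t x : 'rV[R]_3 :=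
  (alpha F k t x * conductivity F k t x) *: grad (temp F k t) x.

Definition conduction k t x : R := divergence (conduction_vec k t) x.

Definition external_heat k t x : R := alpha F k t x * heat_intensity F k t x.

Definition entropy_production t x : R :=
  derive1 (entropy_density ^~ x) t
  + divergence (fun y => entropy_density t y *: velocity F t y) x.

Definition entropy_balance t x : Prop :=
  entropy_production t x =
    \sum_k viscous_power k t x / temp F k t x
    + \sum_k (heat_exchange k t x + conduction k t x + external_heat k t x)
             / temp F k t x.

Definition time_derivable (f : R -> 'rV[R]_3 -> R) t x : Prop :=
  derivable (f ^~ x) t 1.

Record smooth_flow (W : set 'rV[R]_3) t : Prop := SmoothFlow {
  C1_alpha : forall k, C1_on W (alpha F k t);
  C1_density : forall k, C1_on W (density F k t);
  C1_entropy : forall k, C1_on W (entropy F k t);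
  C2_temp : forall k, C2_on W (temp F k t);
  C1_velocity : C1_on W (velocity F t);
  C1_conductivity : forall k, C1_on W (conductivity F k t);
  cont_shear_visc : forall k x, W x -> {for x, continuous (shear_visc F k t)};
  cont_bulk_visc : forall k x, W x -> {for x, continuous (bulk_visc F k t)};
  cont_heat_intensity :
    forall k x, W x -> {for x, continuous (heat_intensity F k t)};
  cont_relax_rate : forall x, W x -> {for x, continuous (relax_rate F t)};
  time_alpha : forall k x, W x -> time_derivable (alpha F k) t x;
  time_density : forall k x, W x -> time_derivable (density F k) t x;
  time_entropy : forall k x, W x -> time_derivable (entropy F k) t x
}.

Record admissible_flow (A : set 'rV[R]_3) t : Prop := AdmissibleFlow {
  alpha_ge0 : forall k x, A x -> 0 <= alpha F k t x;
  alpha_sum1 : forall x, A x -> \sum_k alpha F k t x = 1;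
  density_gt0 : forall k x, A x -> 0 < density F k t x;
  temp_gt0 : forall k x, A x -> 0 < temp F k t x;
  shear_visc_gt0 : forall k x, A x -> 0 < shear_visc F k t x;
  bulk_visc_gt0 : forall k x, A x -> 0 < bulk_visc F k t x;
  conductivity_ge0 : forall k x, A x -> 0 <= conductivity F k t x;
  heat_intensity_ge0 : forall k x, A x -> 0 <= heat_intensity F k t x;
  relax_rate_gt0 : forall x, A x -> 0 < relax_rate F t x
}.

Definition adiabatic_boundary (V : set 'rV[R]_3) t : Prop :=
  forall k x nu, boundary V x -> outward_unit_normal V x nu ->
    dot (conduction_vec k t x) nu = 0.

End Model.

(* Main.v *)
Require Import Defs.
From HB Require Import structures.
From mathcomp Require Import all_boot all_order all_algebra.
From mathcomp Require Import finmap.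
From mathcomp Require Import all_classical all_reals all_analysis.
From mathcomp Require Import measurable_realfun ring lra.

(** Write kappa_k = alpha_k lambda_k. Three of the four terms of the entropy
    source are non-negative at each point. For the stress, with D the strain
    rate, tau_k : D = 2 mu_k (D : D - (tr D)^2 / 3) + mu_b,k (div u)^2, and
    (tr D)^2 <= 3 D : D ([viscous_power_ge0]). The two heat exchanges add up
    to varsigma (T_1 - T_2)^2 / (T_1 T_2) ([heat_exchange_ge0]). The external
    heating is a quotient of non-negative numbers by T_k. Only conduction has
    no sign, and for it ([conduction_div])

      div (kappa_k grad T_k) / T_k
        = div (kappa_k grad T_k / T_k) + kappa_k |grad T_k|^2 / T_k^2.

    The adiabatic condition makes the field H = kappa_k grad T_k / T_k tangent
    to the boundary at its regular points, so everything reduces to a case of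
    the divergence theorem ([integral_div_tangent]): the integral over V of
    div H vanishes for a C1 field H tangent to the boundary. The tangency
    allows a proof that uses no surface integrals.

    The base case is that the divergence of a compactly supported C1 field has
    integral zero over the whole space, by Fubini's theorem and the
    fundamental theorem of calculus on lines ([vint_derive]). The field is
    then cut into pieces supported in small cubes, by cutoffs h. If the cube
    lies in V, the base case applies. If it is centred at a regular boundary
    point, V is {phi < 0} there; h H is multiplied by chi_n = step (n phi), a
    C1 function that tends to the indicator of V, and the base case gives

      0 = int chi_n div (h H) + int h (H . grad chi_n).

    The first term tends to the integral of div (h H) over V. The second tends
    to zero ([vint_B_small]): grad chi_n = n step'(n phi) grad phi lives where
    -1/n < phi < 0, where H . grad phi is small since it vanishes on the
    boundary, and int h n |step'(n phi)| stays bounded, as one sees by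
    integrating by parts in a direction in which the derivative of phi keeps
    away from 0.

    The edges and vertices are not seen by div H. They lie on finitely many
    arcs of finite length, which O(n) cubes of side O(1/n) cover
    ([arcs_cover]). Cutting H off on those cubes changes the integral of its
    divergence by at most O(n) cubes times a volume O(n^-3) times a gradient
    O(n), that is O(1/n) ([int_div_near_cubes]), and what is left of H vanishes
    near the arcs, so that finitely many of the cubes above suffice for it
    ([int_div_away]). *)

Set Implicit Arguments.
Unset Strict Implicit.
Unset Printing Implicit Defensive.

Import Order.TTheory GRing.Theory Num.Theory numFieldNormedType.Exports.

Local Open Scope classical_set_scope.
Local Open Scope ring_scope.

(** * Volume integrals of bounded functions with bounded support *)

Section VolumeIntegral.
Variable R : realType.
Local Notation space := 'rV[R]_3.
Local Notation mu := (@lebesgue_measure R).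
Local Notation volume := (@volume R).
Local Notation line := (measurableTypeR R).
Local Notation coords := (@of_coords R : line * line * line -> space).
Implicit Types (f g : space -> R) (V : set space) (x y a : space) (r M : R).

Lemma ball_coordP a r x :
  0 < r -> (ball a r x <-> forall i, `|a 0 i - x 0 i| < r).
Proof.
move=> r0; rewrite mx_norm_ball /ball_ /=; split.
  move=> axr i; apply: le_lt_trans axr.
  rewrite [leRHS]/Num.Def.normr/= mx_normrE.
  apply: le_trans; last exact: (le_bigmax _ _ (ord0, i)).
  by rewrite !mxE.
move=> H; rewrite [ltLHS]/Num.Def.normr/= mx_normrE.
by apply: bigmax_lt => // -[i j] _; rewrite /= !mxE (ord1 i).
Qed.

Lemma norm_coord_le x i : `|x 0 i| <= `|x|.
Proof.
rewrite [leRHS]/Num.Def.normr/= mx_normrE.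
by apply: le_trans; last exact: (le_bigmax _ _ (ord0, i)).
Qed.

Lemma norm_le_coord x r : 0 <= r -> (forall i, `|x 0 i| <= r) -> `|x| <= r.
Proof.
move=> r0 H; rewrite [leLHS]/Num.Def.normr/= mx_normrE.
by apply: bigmax_le => // -[i j] _; rewrite /= (ord1 i).
Qed.

Lemma of_coords_box (A : 'I_3 -> set R) :
  coords @^-1` [set x | forall i, A i (x 0 i)] =
  (A 0 `*` A 1) `*` A (inord 2).
Proof.
apply/seteqP; split => -[[p q] s] /=.
  move=> H; split; first split.
  - by have := H 0; rewrite /of_coords mxE.
  - by have := H 1; rewrite /of_coords mxE.
  - by have := H (inord 2); rewrite /of_coords mxE inordK.
move=> [[A0 A1] A2] i; rewrite /of_coords mxE /=.
case: i => -[|[|[|//]]] i3 /=.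
- by rewrite (_ : Ordinal i3 = 0) //; exact: val_inj.
- by rewrite (_ : Ordinal i3 = 1) //; exact: val_inj.
- by rewrite (_ : Ordinal i3 = inord 2) //; apply: val_inj; rewrite /= inordK.
Qed.

Lemma ball_boxE a r : 0 < r ->
  ball a r = [set x : space | forall i, (ball (a 0 i) r : set R) (x 0 i)].
Proof.
by move=> r0; apply/seteqP; split => x /=; move/(ball_coordP _ _ r0).
Qed.

Lemma measurable_ball_coords a r :
  measurable (coords @^-1` (ball a r)).
Proof.
have [r0|r0] := ltP 0 r; last first.
  rewrite (_ : ball a r = set0) ?preimage_set0 //.
  apply/seteqP; split => // x; rewrite mx_norm_ball /ball_ /= => h.
  by have := le_lt_trans (normr_ge0 _) (lt_le_trans h r0); rewrite ltxx.
rewrite ball_boxE // (of_coords_box (fun i => ball (a 0 i) r)).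
by apply: measurableX; [apply: measurableX|]; exact: measurable_ball.
Qed.

Lemma volume_ball a r : 0 < r ->
  volume (coords @^-1` (ball a r)) = ((2 * r) ^+ 3)%:E.
Proof.
move=> r0; rewrite ball_boxE // (of_coords_box (fun i => ball (a 0 i) r)).
have ml b : mu (ball b r) = (2 * r)%:E.
  by rewrite lebesgue_measure_ball ?ltW // mulr_natl.
rewrite /volume product_measure1E //=; last 2 first.
- by apply: measurableX; exact: measurable_ball.
- exact: measurable_ball.
rewrite product_measure1E //=; try exact: measurable_ball.
by rewrite !ml -!EFinM; congr EFin; rewrite !exprS expr0; ring.
Qed.

(** The open sets of the topology are measurable for the product
    sigma-algebra because they are countable unions of rational cubes. *)
Lemma measurable_open_coords V : open V -> measurable (coords @^-1` V).
Proof.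
move=> oV.
pose I := (rat * rat * rat * nat)%type.
pose B (j : I) : set space :=
  ball (of_coords (ratr j.1.1.1, ratr j.1.1.2, ratr j.1.2)) (j.2.+1%:R^-1).
pose G (j : I) : set space := [set x | B j `<=` V /\ B j x].
suff -> : V = \bigcup_j G j.
  rewrite preimage_bigcup; apply: countable_bigcupT_measurable.
    exact: countableP.
  move=> j; have [jV|jV] := pselect (B j `<=` V).
    rewrite (_ : G j = B j); first exact: measurable_ball_coords.
    by apply/seteqP; split => x //= [].
  rewrite (_ : G j = set0) ?preimage_set0 //.
  by apply/seteqP; split => x //= [].
apply/seteqP; split => x; last by move=> [j _ [+ +]]; exact.
move=> Vx.
have /nbhs_ballP[e /= e0 xe] : nbhs x V by exact: open_nbhs_nbhs.
pose n := (Num.truncn (2 / e)).+1.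
have n0 : 0 < n.+1%:R^-1 :> R by rewrite invr_gt0.
have ne : n.+1%:R^-1 < e / 2.
  rewrite -[e / 2]invrK ltf_pV2 ?posrE ?invr_gt0 ?divr_gt0 //.
  by rewrite invf_div (lt_trans (truncnS_gt _)) // ltr_nat.
have Q (b : R) : exists q : rat, `|ratr q - b| < n.+1%:R^-1.
  have [q] : exists q, ratr q \in `](b - n.+1%:R^-1), (b + n.+1%:R^-1)[.
    by apply: rat_in_itvoo; rewrite ltrBlDr -addrA ltrDl addr_gt0.
  rewrite in_itv /= => /andP[h1 h2]; exists q.
  by rewrite ltr_distl h1 h2.
have [q0 Q0] := Q (x 0 0); have [q1 Q1] := Q (x 0 1).
have [q2 Q2] := Q (x 0 (inord 2)).
have Bx : B (q0, q1, q2, n) x.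
  apply/(ball_coordP _ _ n0) => i; rewrite /of_coords mxE /=.
  case: i => -[|[|[|//]]] i3 /=.
  - by rewrite (_ : Ordinal i3 = 0) //; exact: val_inj.
  - by rewrite (_ : Ordinal i3 = 1) //; exact: val_inj.
  - by rewrite (_ : Ordinal i3 = inord 2) //; apply: val_inj; rewrite /= inordK.
exists (q0, q1, q2, n) => //; split => // y By; apply: xe.
rewrite (splitr e); apply: ball_triangle; last first.
  by apply: le_ball By; exact: ltW.
by apply/ball_sym; apply: le_ball Bx; exact: ltW.
Qed.

(** A class of integrable functions, stable under sums, multiples and absolute
    values, that spares the integrability proofs; one constant bounds both the
    values and the support. *)
Definition tame f := measurable_fun setT (f \o coords) /\
  exists M, forall x, `|f x| <= M /\ (M < `|x| -> f x = 0).

Definition vint f : R := \int[volume]_p f (coords p).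

Lemma tame_integrable f :
  tame f -> volume.-integrable setT (EFin \o (f \o coords)).
Proof.
move=> [mf [M fM]].
pose B := coords @^-1` (ball (0 : space) (`|M| + 1)).
have mB : measurable B by exact: measurable_ball_coords.
have B0 : 0 < `|M| + 1 by rewrite ltr_wpDl.
have fB : volume.-integrable B (EFin \o (f \o coords)).
  apply: measurable_bounded_integrable => //.
  - by rewrite [ltLHS](volume_ball 0 B0) ltry.
  - exact: measurable_funTS.
  - exists M; split; first exact: num_real.
    move=> N MN p _ /=; apply: le_trans (ltW MN).
    by have [] := fM (of_coords p).
rewrite (_ : EFin \o (f \o coords) = ((EFin \o (f \o coords)) \_ B)%E).
  exact: (integrable_mkcond _ mB).1.
apply/funext => p; rewrite patchE; case: ifPn => // /negP pB /=.
have [_ ->] // := fM (of_coords p).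
rewrite ltNge; apply/negP => pM; apply: pB; apply/mem_set.
rewrite /B /= mx_norm_ball /ball_ /= sub0r normrN.
by apply: le_lt_trans pM _; rewrite (le_lt_trans (ler_norm _)) ?ltrDl.
Qed.

Lemma tame0 : tame (fun _ => 0).
Proof.
split; first exact: measurable_cst.
by exists 0 => x; rewrite normr0.
Qed.

Lemma tameD f g : tame f -> tame g -> tame (fun x => f x + g x).
Proof.
move=> [mf [M fM]] [mg [N gN]]; split; first exact: measurable_funD.
exists (`|M| + `|N|) => x; split.
  apply: le_trans (ler_normD _ _) _; apply: lerD.
    by apply: le_trans (ler_norm _); case: (fM x).
  by apply: le_trans (ler_norm _); case: (gN x).
move=> h; have [_ ->] := fM x; last first.
  apply: le_lt_trans (ler_norm _) _; apply: le_lt_trans h.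
  by rewrite lerDl.
have [_ ->] := gN x; last first.
  apply: le_lt_trans (ler_norm _) _; apply: le_lt_trans h.
  by rewrite lerDr.
by rewrite addr0.
Qed.

Lemma tameZ k f : tame f -> tame (fun x => k * f x).
Proof.
move=> [mf [M fM]]; split; first exact: measurable_funM.
exists (`|k| * `|M| + `|M|) => x; split.
  rewrite normrM; apply: le_trans (_ : `|k| * `|M| <= _); last by rewrite lerDl.
  apply: ler_wpM2l => //.
  by apply: le_trans (ler_norm _); case: (fM x).
move=> h; have [_ ->] := fM x; first by rewrite mulr0.
apply: le_lt_trans (ler_norm _) _; apply: le_lt_trans h.
by rewrite lerDr mulr_ge0.
Qed.

Lemma tameN f : tame f -> tame (fun x => - f x).
Proof.
by move=> /(tameZ (-1)); under eq_fun do rewrite mulN1r.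
Qed.

Lemma tame_sum (I : Type) (s : seq I) (F : I -> space -> R) :
  (forall i, tame (F i)) -> tame (fun x => \sum_(i <- s) F i x).
Proof.
move=> tF; elim: s => [|i s IH].
  by under eq_fun do rewrite big_nil; exact: tame0.
by under eq_fun do rewrite big_cons; exact: tameD.
Qed.

Lemma tame_norm f : tame f -> tame (fun x => `|f x|).
Proof.
move=> [mf [M fM]]; split; first exact: measurableT_comp.
exists M => x; rewrite normr_id; have [h1 h2] := fM x; split => // /h2 ->.
by rewrite normr0.
Qed.

Lemma vintD f g : tame f -> tame g ->
  vint (fun x => f x + g x) = vint f + vint g.
Proof.
by move=> /tame_integrable tf /tame_integrable tg; rewrite /vint RintegralD.
Qed.

Lemma vintZ k f : tame f -> vint (fun x => k * f x) = k * vint f.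
Proof. by move=> /tame_integrable tf; rewrite /vint RintegralZl. Qed.

Lemma vint0 : vint (fun _ => 0) = 0.
Proof. by rewrite /vint Rintegral_cst // mul0r. Qed.

Lemma vint_sum (I : Type) (s : seq I) (F : I -> space -> R) :
  (forall i, tame (F i)) ->
  vint (fun x => \sum_(i <- s) F i x) = \sum_(i <- s) vint (F i).
Proof.
move=> tF; elim: s => [|i s IH].
  by under eq_fun do rewrite big_nil; rewrite vint0 big_nil.
under eq_fun do rewrite big_cons.
by rewrite vintD ?IH ?big_cons //; exact: tame_sum.
Qed.

Lemma le_vint f g : tame f -> tame g -> (forall x, f x <= g x) ->
  vint f <= vint g.
Proof.
by move=> /tame_integrable tf /tame_integrable tg fg; apply: le_Rintegral.
Qed.

Lemma norm_vint_le f : tame f -> `|vint f| <= vint (fun x => `|f x|).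
Proof. by move=> /tame_integrable tf; apply: le_normr_Rintegral. Qed.

Lemma indic_preimage V p :
  \1_(coords @^-1` V) p = \1_V (coords p) :> R.
Proof.
by rewrite !indicE; congr (_%:R); congr nat_of_bool; apply/idP/idP; rewrite !inE.
Qed.

Lemma tame_ball a r : 0 < r -> tame (\1_(ball a r)).
Proof.
move=> r0; split.
  rewrite (_ : _ \o _ = \1_(coords @^-1` ball a r)).
    by apply: measurable_indic; exact: measurable_ball_coords.
  by apply/funext => p; rewrite indic_preimage.
exists (`|a| + r + 1) => x; rewrite indicE; split.
  rewrite ger0_norm ?ler0n //; case: (_ \in _) => /=; last first.
    by rewrite !addr_ge0 // ltW.
  by rewrite ler_wpDl // addr_ge0 // ltW.
move=> h; rewrite (_ : _ \in _ = false) //; apply/negP; rewrite inE.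
rewrite mx_norm_ball /ball_ /= => ax.
have := ler_normD (x - a) a; rewrite subrK distrC; lra.
Qed.

Lemma vint_ball a r : 0 < r -> vint (\1_(ball a r)) = (2 * r) ^+ 3.
Proof.
move=> r0; rewrite /vint.
rewrite (_ : (fun p => _) = \1_(coords @^-1` ball a r)); last first.
  by apply/funext => p; rewrite indic_preimage.
rewrite /Rintegral integral_indic //; last exact: measurable_ball_coords.
by rewrite setIT [X in fine X](volume_ball a r0).
Qed.

Lemma bounded_closure_compact V : bounded_set V -> compact (closure V).
Proof.
move=> [M [_ VM]]; apply: bounded_closed_compact; last exact: closed_closure.
exists (M + 1); split; first exact: num_real.
move=> N MN x /= Vx; rewrite leNgt; apply/negP => Nx.
have [|y [Vy xy]] := Vx (ball x (`|x| - (M + 1))).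
  by apply: nbhsx_ballx; lra.
have yM : `|y| <= M + 1 by apply: VM => //; rewrite ltrDl.
move: xy; rewrite mx_norm_ball /ball_ /= => xy.
have := ler_normD (x - y) y; rewrite subrK; lra.
Qed.

Lemma bounded_on_compact (A : set space) f : compact A ->
  (forall x, A x -> {for x, continuous f}) ->
  exists M, forall x, A x -> `|f x| <= M.
Proof.
move=> cA cf; have [->|/set0P[x Ax]] := eqVneq A set0; first by exists 0.
have cn : {within A, continuous (fun x => `|f x|)}.
  apply: continuous_in_subspaceT => y /set_mem Ay.
  by apply: continuous_comp; [exact: cf|exact: norm_continuous].
have [c _ cM] := compact_EVT_max (ex_intro _ x Ax) cA cn.
by exists `|f c| => y Ay; apply: cM; exact/mem_set.
Qed.

(** The bound comes from the compactness of the closure of V, and measurability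
    from the superlevel sets of f in V, which are open. *)
Lemma tame_patch V f : open V -> bounded_set V ->
  (forall x, closure V x -> {for x, continuous f}) -> tame (f \_ V).
Proof.
move=> oV bV cf.
have [M VM] := bounded_on_compact (bounded_closure_compact bV) cf.
have [N [_ VN]] := bV.
split; last first.
  exists (`|M| + `|N + 1|) => x; rewrite patchE; case: ifPn => [/set_mem Vx|_].
    split.
      apply: le_trans (VM x _) _; first exact: subset_closure.
      by apply: le_trans (ler_norm _) _; rewrite lerDl.
    have xN : `|x| <= N + 1 by apply: VN => //; rewrite ltrDl.
    move=> h; have := lt_le_trans h xN; have := ler_norm (N + 1).
    have := normr_ge0 M; lra.
  by rewrite normr0; split => //; rewrite addr_ge0.
have mV := measurable_open_coords oV.
rewrite (_ : _ \o _ = (f \o coords) \_ (coords @^-1` V)); last first.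
  apply/funext => p /=; rewrite !patchE.
  by rewrite (_ : (p \in _) = (of_coords p \in V)) //; apply/idP/idP; rewrite !inE.
apply/(measurable_restrictT _ mV) => _ Y mY.
suff H : (measurable_fun (coords @^-1` V) (f \o coords)) by exact: H.
apply: measurability (RGenOInfty.measurableE R) _.
move=> _ [_ [b ->] <-].
have oP : open (V `&` [set x | b < f x]).
  rewrite openE => x [Vx bx]; apply: filterI; first exact: open_nbhs_nbhs.
  apply: (cf x (subset_closure Vx) [set y | b < y]).
  by apply: open_nbhs_nbhs; split => //; exact: open_gt.
have := measurable_open_coords oP; congr measurable.
by apply/seteqP; split => p /=; rewrite in_itv /= andbT.
Qed.

End VolumeIntegral.

(** * Integrals of partial derivatives *)

Section IntegralDerivative.
Variable R : realType.
Local Notation space := 'rV[R]_3.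
Local Notation mu := (@lebesgue_measure R).
Local Notation volume := (@volume R).
Local Notation line := (measurableTypeR R).
Local Notation coords := (@of_coords R : line * line * line -> space).
Local Notation e_ i := (basis_vec R i).

Lemma norm_gt_near (V : normedModType R) (x : V) (M : R) :
  M < `|x| -> \forall z \near x, M < `|z|.
Proof. by move=> Mx; apply: (@cvgr_norm_gt _ _ _ _ _ id x) => //. Qed.

Lemma line_quotient (f : space -> R) (y v : space) (s : R) :
  (fun h : R => h^-1 *: (((fun r : R => f (r *: v + y)) \o shift s) (h *: 1)
                        - f (s *: v + y))) =
  (fun h => h^-1 *: ((f \o shift (s *: v + y)) (h *: v) - f (s *: v + y))).
Proof. by apply/funext => h /=; rewrite [h%:A]mulr1 scalerDl -addrA. Qed.

Lemma derivable_line (f : space -> R) (y v : space) (s : R) :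
  derivable ((fun r : R => f (r *: v + y)) : R -> R) s 1 <->
  derivable f (s *: v + y) v.
Proof. by rewrite /derivable line_quotient. Qed.

Lemma derive1_line (f : space -> R) (y v : space) (s : R) :
  derive1 (fun s => f (s *: v + y)) s = 'D_v f (s *: v + y).
Proof. by rewrite derive1E /derive line_quotient. Qed.

Lemma integral_derive1_compact (g : R -> R) (M : R) :
  (forall s, derivable g s 1) -> continuous (derive1 g) ->
  (forall s, M < `|s| -> g s = 0) ->
  (\int[mu]_s (derive1 g s)%:E = 0)%E.
Proof.
move=> dg cg g0; pose N : R := `|M| + 1; pose J : set R := `[- N, N]%classic.
have MN : M < N by rewrite (le_lt_trans (ler_norm _)) ?ltrDl.
have N0 : 0 < N by rewrite ltr_wpDl.
have gN s : N <= `|s| -> g s = 0.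
  by move=> h; apply: g0; exact: lt_le_trans MN h.
rewrite (_ : (fun s => _) = ((EFin \o derive1 g) \_ J)%E); last first.
  apply/funext => s; rewrite patchE; case: ifPn => //.
  rewrite notin_setE /J /= in_itv /= -ler_norml => /negP; rewrite -ltNge => Ns.
  rewrite derive1E; congr EFin; transitivity ('D_1 (cst 0 : R -> R) s).
    2: exact: derive_cst.
  apply: near_eq_derive; apply: filterS (norm_gt_near Ns) => z /ltW.
  exact: gN.
rewrite -integral_mkcond.
have -> : (0 = (g N)%:E - (g (- N))%:E)%E.
  by rewrite !gN ?subee // ?normrN ger0_norm // ltW.
have NN : - N < N by rewrite gtrN.
have cN : {within `[- N, N], continuous (derive1 g)}.
  exact: continuous_subspaceT.
have cg' x : {for x, continuous g}.
  by apply: differentiable_continuous; exact/derivable1_diffP.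
have dN : derivable_oo_LRcontinuous g (- N) N.
  split; first by move=> x _; apply: dg.
    by apply: cvg_at_right_filter; exact: cg'.
  by apply: cvg_at_left_filter; exact: cg'.
exact: (continuous_FTC2 NN cN dN (fun x _ => erefl)).
Qed.

Lemma of_coords_slice2 (p q s : R) :
  coords (p, q, s) = s *: e_ (inord 2) + of_coords (p, q, 0).
Proof.
apply/rowP => -[[|[|[|//]]] i]; rewrite /of_coords /basis_vec !mxE /=;
  rewrite -val_eqE /= inordK //= ?mulr0 ?mulr1 ?add0r ?addr0 //.
Qed.

Lemma of_coords_slice1 (p q s : R) :
  coords (p, s, q) = s *: e_ 1 + of_coords (p, 0, q).
Proof.
by apply/rowP => -[[|[|[|//]]] i]; rewrite /of_coords /basis_vec !mxE /=
  -?val_eqE /= ?mulr0 ?mulr1 ?add0r ?addr0.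
Qed.

Lemma of_coords_slice0 (p q s : R) :
  coords (s, p, q) = s *: e_ 0 + of_coords (0, p, q).
Proof.
by apply/rowP => -[[|[|[|//]]] i]; rewrite /of_coords /basis_vec !mxE /=
  -?val_eqE /= ?mulr0 ?mulr1 ?add0r ?addr0.
Qed.

Lemma norm_basis_vec i : `|e_ i| = 1.
Proof.
apply/eqP; rewrite eq_le; apply/andP; split.
  apply: norm_le_coord => // j; rewrite /basis_vec mxE eqxx /=.
  by case: eqP => _; rewrite ?normr1 ?normr0.
have := norm_coord_le (e_ i) i.
by rewrite /basis_vec mxE !eqxx normr1.
Qed.

Lemma derive_zero_off (f : space -> R) (M : R) v x :
  (forall x, M < `|x| -> f x = 0) -> M < `|x| -> 'D_v f x = 0.
Proof.
move=> f0 Mx; transitivity ('D_v (cst 0 : space -> R) x); last exact: derive_cst.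
apply: near_eq_derive; apply: filterS (norm_gt_near Mx) => z; exact: f0.
Qed.

Lemma continuous_tame (f : space -> R) (M : R) :
  continuous f -> (forall x, M < `|x| -> f x = 0) -> tame f.
Proof.
move=> cf f0.
rewrite (_ : f = f \_ (ball (0 : space) (`|M| + 1))).
  apply: tame_patch => //; first exact: ball_open.
    exists (`|M| + 1); split; first exact: num_real.
    move=> N MN x /=; rewrite mx_norm_ball /ball_ /= sub0r normrN => h.
    by apply/ltW/(lt_trans h).
  by move=> x _; exact: cf.
apply/funext => x; rewrite patchE; case: ifPn => //.
rewrite notin_setE mx_norm_ball /ball_ /= sub0r normrN => /negP.
rewrite -leNgt => h; apply: f0; apply: lt_le_trans h.
by rewrite (le_lt_trans (ler_norm _)) // ltrDl.
Qed.

(** Fubini's theorem is applied first to the plane times a line and then inside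
    the plane; the name carries the sigma-finiteness that the plane needs as a
    factor. *)
Definition area : set (line * line) -> \bar R := (mu \x mu)%E.

HB.instance Definition _ := Measure.on area.

Lemma area_sigma_finite : sigma_finite setT area.
Proof.
exists (fun n => ball (0 : R) n.+1%:R `*` ball (0 : R) n.+1%:R).
  apply/seteqP; split => // -[p q] _; exists (Num.truncn (`|p| + `|q|)) => //.
  have h := truncnS_gt (`|p| + `|q|).
  by split; rewrite /ball /= sub0r normrN; apply: le_lt_trans h;
    rewrite ?lerDl ?lerDr.
move=> n; split; first by apply: measurableX; exact: measurable_ball.
rewrite /area product_measure1E; try exact: measurable_ball.
have bE : mu (ball (0 : R) n.+1%:R) = (n.+1%:R *+ 2)%:E.
  by rewrite lebesgue_measure_ball.
by rewrite [X in (X * _)%E]bE [X in (_ * X)%E]bE -EFinM ltry.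
Qed.

HB.instance Definition _ :=
  Measure_isSigmaFinite.Build _ _ _ area area_sigma_finite.

Lemma integrable_slice (f : space -> R) (r : R) : tame f ->
  area.-integrable setT (fun q => (f (coords (q, r)))%:E).
Proof.
move=> [mf [M fM]].
pose J := ball (0 : R) (`|M| + 1).
have N0 : 0 < `|M| + 1 by rewrite ltr_wpDl.
have mJ : measurable (J `*` J : set (line * line)).
  by apply: measurableX; exact: measurable_ball.
have JE : mu J = ((`|M| + 1) *+ 2)%:E by rewrite lebesgue_measure_ball // ltW.
have iJ : area.-integrable (J `*` J) (fun q => (f (coords (q, r)))%:E).
  apply: measurable_bounded_integrable => //.
  - rewrite [X in (X < _)%E]product_measure1E; try exact: measurable_ball.
    by rewrite [X in (X * _)%E]JE [X in (_ * X)%E]JE -EFinM ltry.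
  - apply: measurable_funTS; apply: measurableT_comp mf _.
    by apply: measurable_fun_pair; [exact: measurable_id|exact: measurable_cst].
  - exists M; split; first exact: num_real.
    move=> N MN q _ /=; apply: le_trans (ltW MN).
    by have [] := fM (of_coords (q, r)).
rewrite (_ : (fun q => _) = ((fun q => (f (coords (q, r)))%:E) \_ (J `*` J))%E).
  exact: (integrable_mkcond _ mJ).1.
apply/funext => q; rewrite patchE; case: ifPn => // /negP qJ.
congr EFin; have [_ ->] // := fM (coords (q, r)).
rewrite ltNge; apply/negP => qM; apply: qJ; apply/mem_set.
have qN i : `|(coords (q, r)) 0 i| < `|M| + 1.
  apply: le_lt_trans (norm_coord_le _ _) _; apply: le_lt_trans qM _.
  by rewrite (le_lt_trans (ler_norm _)) // ltrDl.
by split; rewrite /J /ball /= sub0r normrN; [have := qN 0|have := qN 1];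
  rewrite /of_coords mxE.
Qed.

Lemma ord3P (i : 'I_3) : [\/ i = 0, i = 1 | i = inord 2].
Proof.
case: i => -[|[|[|//]]] i3.
- by constructor 1; exact: val_inj.
- by constructor 2; exact: val_inj.
- by constructor 3; apply: val_inj; rewrite /= inordK.
Qed.

Section LineIntegral.
Variables (f : space -> R) (M : R) (i : 'I_3).
Hypothesis df : forall x, derivable f x (e_ i).
Hypothesis cf : continuous ('D_(e_ i) f).
Hypothesis f0 : forall x, M < `|x| -> f x = 0.

Lemma integral_derive_line y :
  (\int[mu]_s ('D_(e_ i) f (s *: e_ i + y))%:E = 0)%E.
Proof.
transitivity (\int[mu]_s (derive1 (fun s => f (s *: e_ i + y)) s)%:E)%E.
  by apply: eq_integral => s _; rewrite derive1_line.
apply: (@integral_derive1_compact _ (`|M| + `|y|)).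
- by move=> s; exact/derivable_line.
- rewrite (_ : derive1 _ = 'D_(e_ i) f \o (fun s => s *: e_ i + y)).
    move=> s; apply: continuous_comp; last exact: cf.
    by apply: cvgD; [apply: cvgZr_tmp; exact: cvg_id|exact: cvg_cst].
  by apply/funext => s; rewrite derive1_line.
- move=> s h; apply: f0; have := ler_normD (s *: e_ i + y) (- y).
  rewrite addrK normrN normrZ norm_basis_vec mulr1 => h2.
  have := ler_norm M; lra.
Qed.

Lemma tame_derive : tame ('D_(e_ i) f).
Proof. by apply: (@continuous_tame _ M) => // x; exact: derive_zero_off. Qed.

End LineIntegral.

(** Fubini's theorem, integrating first along the lines parallel to the
    direction of differentiation, where the fundamental theorem of calculus
    gives zero. *)
Lemma vint_derive (f : space -> R) (M : R) i :
  (forall x, derivable f x (e_ i)) -> continuous ('D_(e_ i) f) ->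
  (forall x, M < `|x| -> f x = 0) -> vint ('D_(e_ i) f) = 0.
Proof.
move=> df cf f0.
have tf := tame_derive cf f0; have itf := tame_integrable tf.
suff H : (\int[volume]_p (('D_(e_ i) f) (coords p))%:E = 0)%E.
  by rewrite /vint /Rintegral; rewrite H.
have line0 := integral_derive_line df cf f0.
pose F := EFin \o ('D_(e_ i) f \o coords) : line * line * line -> \bar R.
have iF : (area \x mu)%E.-integrable setT F by exact: itf.
have E12 := @integral12_prod_meas1 _ _ (line * line)%type line R area mu F iF.
have E21 := @integral21_prod_meas1 _ _ (line * line)%type line R area mu F iF.
have slice0 r : (\int[area]_q F (q, r) = 0)%E \/ i = inord 2.
  have [->|i2] := eqVneq i (inord 2); [by right|left].
  have tr : area.-integrable setT (fun q => F (q, r)).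
    exact: (integrable_slice r tf).
  have [i0|i1|i2'] := ord3P i; last by rewrite i2' eqxx in i2.
  - rewrite -[LHS](@integral21_prod_meas1 _ _ line line R mu mu (fun q => F (q, r))) //.
    apply: integral0_eq => q _; rewrite /fubini_G.
    under eq_integral => p _ do rewrite /F /= of_coords_slice0 -i0.
    exact: line0.
  - rewrite -[LHS](@integral12_prod_meas1 _ _ line line R mu mu (fun q => F (q, r))) //.
    apply: integral0_eq => p _; rewrite /fubini_F.
    under eq_integral => q _ do rewrite /F /= of_coords_slice1 -i1.
    exact: line0.
have [i2|i2] := eqVneq i (inord 2).
  transitivity (\int[area]_x fubini_F mu F x)%E; first by rewrite E12.
  apply: integral0_eq => -[p q] _; rewrite /fubini_F.
  under eq_integral => r _ do rewrite /F /= of_coords_slice2 -i2.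
  exact: line0.
transitivity (\int[mu]_x fubini_G area F x)%E; first by rewrite E21.
apply: integral0_eq => r _; rewrite /fubini_G.
by have [->|i2'] := slice0 r; last by rewrite i2' eqxx in i2.
Qed.

End IntegralDerivative.

(** * Calculus of C1 functions *)

Section C1.
Variable R : realType.
Local Notation space := 'rV[R]_3.
Local Notation e_ i := (basis_vec R i).
Implicit Types (f g : space -> R) (W U : set space) (x v : space).

Lemma continuous_for_near f g x : (\near x, f x = g x) ->
  {for x, continuous g} -> {for x, continuous f}.
Proof.
move=> fg; have fgx := nbhs_singleton fg.
rewrite /prop_for /continuous_at fgx; apply: cvg_trans.
apply: (@near_eq_cvg _ _ (nbhs x) _ g f); near=> z; apply/esym; near: z.
exact: fg.
Unshelve. all: by end_near.
Qed.

Lemma continuous_mul f g x : {for x, continuous f} -> {for x, continuous g} ->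
  {for x, continuous (fun y => f y * g y)}.
Proof. exact: continuousM. Qed.

Lemma continuous_add f g x : {for x, continuous f} -> {for x, continuous g} ->
  {for x, continuous (fun y => f y + g y)}.
Proof. exact: continuousD. Qed.

Lemma continuous_opp f x : {for x, continuous f} ->
  {for x, continuous (fun y => - f y)}.
Proof. exact: continuousN. Qed.

Lemma continuous_inv f x : f x != 0 -> {for x, continuous f} ->
  {for x, continuous (fun y => (f y)^-1)}.
Proof. exact: continuousV. Qed.

Lemma continuous_comp1 (h : R -> R) f x : {for x, continuous f} ->
  continuous h -> {for x, continuous (fun y => h (f y))}.
Proof. by move=> cf ch; apply: continuous_comp => //; exact: ch. Qed.

Lemma continuous_cst (c : R) x : {for x, continuous (fun _ : space => c)}.
Proof. exact: cst_continuous. Qed.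

Lemma continuous_sum (I : Type) (s : seq I) (F : I -> space -> R) x :
  (forall i, {for x, continuous (F i)}) ->
  {for x, continuous (fun y => \sum_(i <- s) F i y)}.
Proof.
move=> cF; elim: s => [|i s IH].
  suff -> : (fun y => \sum_(i <- [::]) F i y) = (fun _ => 0).
    exact: continuous_cst.
  by apply/funext => y; rewrite big_nil.
suff -> : (fun y => \sum_(j <- i :: s) F j y) =
          (fun y => F i y + \sum_(j <- s) F j y) by exact: continuous_add.
by apply/funext => y; rewrite big_cons.
Qed.

Lemma C1_on_sub W U f : U `<=` W -> C1_on W f -> C1_on U f.
Proof. by move=> UW cf x /UW; exact: cf. Qed.

Lemma C1_on_continuous W f x : C1_on W f -> W x -> {for x, continuous f}.
Proof. by move=> cf /cf[df _]; exact: differentiable_continuous. Qed.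

(** The difference f - g vanishes near x, hence has differential zero there. *)
Lemma near_eq_differentiable (V V' : normedModType R) (f g : V -> V') (x : V) :
  (\near x, f x = g x) -> differentiable g x -> differentiable f x.
Proof.
move=> fg dg; pose k y := f y - g y.
have k0 : \near x, k x = 0.
  by apply: filterS fg => z fgz; rewrite /k fgz subrr.
pose z : {linear V -> V'} := \0.
have kE : k \o shift x = cst (k x) + z +o_0 id.
  apply/eqaddoP => e e0; rewrite (nbhs_singleton k0).
  have : \forall h \near (0 : V), k (h + x) = 0.
    have sx : (h + x) @[h --> (0 : V)] --> x.
      rewrite -[X in _ --> X]add0r; apply: cvgD; first exact: cvg_id.
      exact: cvg_cst.
    exact: sx k0.
  apply: filterS => h kh; rewrite !fctE /= kh addr0 subr0 normr0.
  by rewrite mulr_ge0 // ltW.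
have dk : 'd k x = z :> (V -> V').
  by apply: (@diff_unique R V V' k z x) => // y; exact: cst_continuous.
have -> : f = g + k by apply/funext => y; rewrite fctE /k addrC subrK.
apply: differentiableD => //; apply/diff_locallyP; rewrite dk; split => //.
by move=> y; exact: cst_continuous.
Qed.

Lemma C1_on_near W f g : open W ->
  (forall x, W x -> \near x, f x = g x) -> C1_on W g -> C1_on W f.
Proof.
move=> oW fg cg x Wx; have [dg cDg] := cg x Wx; split.
  exact: near_eq_differentiable (fg x Wx) dg.
move=> i; apply: continuous_for_near (cDg i).
near=> y; apply: near_eq_derive; apply: fg; near: y.
exact: open_nbhs_nbhs.
Unshelve. all: by end_near.
Qed.

Lemma derive_mul f g x v : differentiable f x -> differentiable g x ->
  'D_v (fun y => f y * g y) x = f x * 'D_v g x + g x * 'D_v f x.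
Proof.
move=> df dg; have := @deriveM R _ f g x v.
by rewrite /GRing.scale /=; apply; exact: diff_derivable.
Qed.

Lemma derive_add f g x v : differentiable f x -> differentiable g x ->
  'D_v (fun y => f y + g y) x = 'D_v f x + 'D_v g x.
Proof.
by move=> df dg; have := @deriveD R _ _ f g x v; apply; exact: diff_derivable.
Qed.

Lemma derive_comp1 (h : R -> R) f x v : derivable h (f x) 1 ->
  differentiable f x ->
  'D_v (fun y => h (f y)) x = derive1 h (f x) * 'D_v f x.
Proof.
move=> /derivable1_diffP dh df.
have dhf := differentiable_comp df dh.
rewrite (deriveE v df) (deriveE v dhf) diff_comp //= derive1E' //.
rewrite -[X in 'd h (f x) X]mulr1 (_ : 'd f x v * 1 = 'd f x v *: (1 : R)) //.
by rewrite linearZ mulrC.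
Qed.

Lemma C1_onM W f g : open W -> C1_on W f -> C1_on W g ->
  C1_on W (fun x => f x * g x).
Proof.
move=> oW cf cg x Wx; have [df cDf] := cf x Wx; have [dg cDg] := cg x Wx.
split; first exact: differentiableM.
move=> i; pose D y := f y * 'D_(e_ i) g y + g y * 'D_(e_ i) f y.
apply: (@continuous_for_near _ D).
  near=> y; rewrite /D derive_mul //.
    by have [] := cf y; first by near: y; exact: open_nbhs_nbhs.
  by have [] := cg y; first by near: y; exact: open_nbhs_nbhs.
have ctf := C1_on_continuous cf Wx; have ctg := C1_on_continuous cg Wx.
by apply: continuous_add; apply: continuous_mul.
Unshelve. all: by end_near.
Qed.

Lemma C1_onD W f g : open W -> C1_on W f -> C1_on W g ->
  C1_on W (fun x => f x + g x).
Proof.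
move=> oW cf cg x Wx; have [df cDf] := cf x Wx; have [dg cDg] := cg x Wx.
split; first exact: differentiableD.
move=> i; pose D y := 'D_(e_ i) f y + 'D_(e_ i) g y.
apply: (@continuous_for_near _ D).
  near=> y; rewrite /D derive_add //.
    by have [] := cf y; first by near: y; exact: open_nbhs_nbhs.
  by have [] := cg y; first by near: y; exact: open_nbhs_nbhs.
exact: continuous_add.
Unshelve. all: by end_near.
Qed.

Lemma C1_on_cst W (c : R) : C1_on W (fun _ => c).
Proof.
move=> x _; split; first exact: differentiable_cst.
move=> i; rewrite (_ : 'D_(e_ i) _ = fun _ => 0); first exact: continuous_cst.
by apply/funext => y; exact: derive_cst.
Qed.

Lemma C1_on_comp W (h : R -> R) f : open W ->
  (forall s, derivable h s 1) -> continuous (derive1 h) -> C1_on W f ->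
  C1_on W (fun x => h (f x)).
Proof.
move=> oW dh ch cf x Wx; have [df cDf] := cf x Wx; split.
  by apply: differentiable_comp => //; apply/derivable1_diffP.
move=> i; pose D y := derive1 h (f y) * 'D_(e_ i) f y.
apply: (@continuous_for_near _ D).
  near=> y; rewrite /D derive_comp1 //.
  by have [] := cf y; first by near: y; exact: open_nbhs_nbhs.
apply: continuous_mul (cDf i); apply: continuous_comp1 => //.
exact: C1_on_continuous cf Wx.
Unshelve. all: by end_near.
Qed.

Lemma C1_onV W f : open W -> C1_on W f -> (forall x, W x -> f x != 0) ->
  C1_on W (fun x => (f x)^-1).
Proof.
move=> oW cf f0 x Wx; have [df cDf] := cf x Wx; split.
  exact: differentiableV (f0 x Wx).
move=> i; pose D y := - (f y ^- 2) * 'D_(e_ i) f y.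
apply: (@continuous_for_near _ D).
  near=> y; have Wy : W y by near: y; exact: open_nbhs_nbhs.
  have [dfy _] := cf y Wy.
  by rewrite /D deriveV //; [exact: f0|exact: diff_derivable].
have ctf := C1_on_continuous cf Wx.
apply: continuous_mul (cDf i); apply: continuous_opp; apply: continuous_inv.
  by rewrite expf_neq0 // f0.
exact: continuous_mul.
Unshelve. all: by end_near.
Qed.

Lemma derive_coord (i j : 'I_3) x : 'D_(e_ i) (fun y : space => y 0 j) x = (i == j)%:R.
Proof.
rewrite /derive; apply: cvg_lim => //; apply: cvg_near_cst.
near=> h; rewrite /= !mxE addrK eqxx /= eq_sym -[_ *: _]/(_ * _).
by rewrite mulrA mulVf ?mul1r //; near: h; exact: nbhs_dnbhs_neq.
Unshelve. all: by end_near.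
Qed.

Lemma C1_on_coord W (j : 'I_3) : C1_on W (fun x : space => x 0 j).
Proof.
move=> x _; split; first exact: differentiable_coord.
move=> i; rewrite (_ : 'D_(e_ i) _ = fun _ => (i == j)%:R : R).
  exact: continuous_cst.
by apply/funext => y; exact: derive_coord.
Qed.

(** As K is closed, f vanishes near each point off K, and those points
    together with W fill the space. *)
Lemma C1_on_glue W K f : open W -> closed K -> K `<=` W -> C1_on W f ->
  (forall x, ~ K x -> f x = 0) -> C1_on setT f.
Proof.
move=> oW cK KW cf f0 x _; have [Kx|Kx] := pselect (K x); first exact/cf/KW.
have oKC : open (~` K) by exact: closed_openC.
apply: (C1_on_near (g := fun _ => 0) oKC) => //; last exact: C1_on_cst.
move=> y Ky; near=> z; apply: f0; suff : (~` K) z by [].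
by near: z; exact: open_nbhs_nbhs.
Unshelve. all: by end_near.
Qed.

Lemma derive_off_closed K f v x : closed K -> (forall y, ~ K y -> f y = 0) ->
  ~ K x -> 'D_v f x = 0.
Proof.
move=> cK f0 Kx; transitivity ('D_v (cst 0 : space -> R) x).
  2: exact: derive_cst.
apply: near_eq_derive; near=> z; apply: f0; suff : (~` K) z by [].
by near: z; apply: open_nbhs_nbhs; split => //; exact: closed_openC.
Unshelve. all: by end_near.
Qed.

End C1.

(** * Cutoff functions *)

Section Cutoff.
Variable R : realType.
Local Notation space := 'rV[R]_3.
Implicit Types (s : R) (a x : space).

Definition pos_part s : R := Num.max s 0.
Definition pos_sqr s : R := pos_part s ^+ 2.

Lemma pos_part_ge0 s : 0 <= pos_part s.
Proof. by rewrite le_max lexx orbT. Qed.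

Lemma pos_part_id s : 0 <= s -> pos_part s = s.
Proof. by move=> s0; rewrite /pos_part max_l. Qed.

Lemma pos_part_eq0 s : s <= 0 -> pos_part s = 0.
Proof. by move=> s0; rewrite /pos_part max_r. Qed.

Lemma continuous_pos_part : continuous pos_part.
Proof.
move=> s; apply: (@continuous_max _ _ (@id R) (cst 0)) => //.
exact: cst_continuous.
Qed.

(** A second order expansion with remainder at most h^2, which gives the
    derivative of [pos_sqr] at 0 as well as elsewhere. *)
Lemma pos_sqr_taylor s h :
  0 <= pos_sqr (s + h) - pos_sqr s - 2 * pos_part s * h <= h ^+ 2.
Proof.
rewrite /pos_sqr.
have [s0|s0] := leP 0 s; have [h0|h0] := leP 0 (s + h);
  rewrite ?(pos_part_id s0) ?(pos_part_id h0) ?(pos_part_eq0 (ltW s0))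
    ?(pos_part_eq0 (ltW h0)); apply/andP; split; nra.
Qed.

Lemma is_derive_pos_sqr s : is_derive s (1 : R) pos_sqr (2 * pos_part s).
Proof.
suff H : (fun h => h^-1 *: ((pos_sqr \o shift s) (h *: 1) - pos_sqr s)) @ 0^'
         --> 2 * pos_part s.
  apply: DeriveDef; first by apply/cvg_ex; exists (2 * pos_part s).
  exact: cvg_lim H.
apply/cvgrPdist_le => e e0; near=> h.
have h0 : h != 0 by near: h; exact: nbhs_dnbhs_neq.
have he : `|h| <= e by near: h; apply: dnbhs0_le.
apply: le_trans he; rewrite /= [h%:A]mulr1 [h + s]addrC -[_ *: _]/(_ * _).
have := pos_sqr_taylor s h; set D := _ - _ - _ => /andP[D0 Dh].
rewrite (_ : 2 * pos_part s - _ = - (h^-1 * D)); last first.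
  by rewrite /D; field.
rewrite normrN normrM normfV (ger0_norm D0) mulrC ler_pdivrMr ?normr_gt0 //.
by rewrite -expr2 real_normK // num_real.
Unshelve. all: by end_near.
Qed.

(** A C1 step, equal to 1 up to -1, decreasing from there, and equal to 0 from
    0 on: the two terms of the denominator have no common zero. *)
Definition step s : R := pos_sqr (- s) / (pos_sqr (- s) + pos_sqr (1 + s)).

Definition dstep s : R :=
  - (2 * (pos_part (- s) * pos_sqr (1 + s) + pos_sqr (- s) * pos_part (1 + s)))
  / (pos_sqr (- s) + pos_sqr (1 + s)) ^+ 2.

Lemma step_den_gt0 s : 0 < pos_sqr (- s) + pos_sqr (1 + s).
Proof.
rewrite /pos_sqr; have [s0|s0] := ltP s 0.
  by rewrite ltr_wpDr ?sqr_ge0 // pos_part_id ?oppr_ge0 ?(ltW s0) //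
    exprn_gt0 // oppr_gt0.
rewrite ltr_wpDl ?sqr_ge0 // pos_part_id ?exprn_gt0 //; lra.
Qed.

Lemma is_derive_step s : is_derive s (1 : R) step (dstep s).
Proof.
have dN : is_derive s (1 : R) (fun s => pos_sqr (- s)) (- (2 * pos_part (- s))).
  have := @is_derive1_comp _ pos_sqr (-%R) s _ _
    (is_derive_pos_sqr (- s)) (is_deriveN (is_derive_id s 1)).
  by rewrite mulrN1.
have dP : is_derive s (1 : R) (fun s => pos_sqr (1 + s)) (2 * pos_part (1 + s)).
  have := @is_derive1_comp _ pos_sqr (fun s => 1 + s) s _ _
    (is_derive_pos_sqr (1 + s))
    (is_deriveD (is_derive_cst (1 : R) s (1 : R)) (is_derive_id s (1 : R))).
  by rewrite add0r mulr1.
have d0 := step_den_gt0 s.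
have d0' : ((fun s => pos_sqr (- s)) + (fun s => pos_sqr (1 + s))) s != 0.
  by rewrite fctE gt_eqF.
have dM := is_deriveM dN (is_deriveV d0' (is_deriveD dN dP)).
apply: is_derive_eq dM _.
rewrite !fctE /GRing.scale /dstep /pos_sqr /=; field.
exact: lt0r_neq0 d0.
Qed.

Lemma derivable_step s : derivable step s 1.
Proof. exact: (@ex_derive _ _ _ _ _ _ _ (is_derive_step s)). Qed.

Lemma derive1_step : derive1 step = dstep.
Proof.
by apply/funext => s; rewrite derive1E;
  exact: (@derive_val _ _ _ _ _ _ _ (is_derive_step s)).
Qed.

Lemma continuous_derive1_step : continuous (derive1 step).
Proof.
rewrite derive1_step => s.
have cN : {for s, continuous (fun s => pos_part (- s))}.
  apply: continuous_comp; first exact: opp_continuous.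
  exact: continuous_pos_part.
have cP : {for s, continuous (fun s => pos_part (1 + s))}.
  apply: continuous_comp; last exact: continuous_pos_part.
  by apply: cvgD; [exact: cvg_cst|exact: cvg_id].
have cN2 : {for s, continuous (fun s => pos_sqr (- s))}.
  exact: (continuousM cN cN).
have cP2 : {for s, continuous (fun s => pos_sqr (1 + s))}.
  exact: (continuousM cP cP).
have c2 : {for s, continuous (cst (2 : R) : R -> R)} by exact: cst_continuous.
have cD := continuousD cN2 cP2.
have cnum := continuousN (continuousM c2 (continuousD (continuousM cN cP2)
  (continuousM cN2 cP))).
pose den s : R := pos_sqr (- s) + pos_sqr (1 + s).
have d0 : den s * den s != 0 by rewrite mulf_neq0 // gt_eqF // step_den_gt0.
have cV := @continuousV _ _ (fun u => den u * den u) s d0 (continuousM cD cD).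
have := continuousM cnum cV.
by rewrite /prop_for (_ : _ \* _ = dstep).
Qed.

Lemma step_ge0 s : 0 <= step s.
Proof. by rewrite /step divr_ge0 ?sqr_ge0 // ltW // step_den_gt0. Qed.

Lemma step_le1 s : step s <= 1.
Proof. by rewrite /step ler_pdivrMr ?step_den_gt0 // mul1r lerDl sqr_ge0. Qed.

Lemma step1 s : s <= -1 -> step s = 1.
Proof.
move=> s1; have := step_den_gt0 s; rewrite /step.
rewrite (_ : pos_sqr (1 + s) = 0) ?addr0 => [d0|].
  by rewrite divff // gt_eqF.
by rewrite /pos_sqr pos_part_eq0 ?expr0n //; lra.
Qed.

Lemma step0 s : 0 <= s -> step s = 0.
Proof.
by move=> s0; rewrite /step {1}/pos_sqr pos_part_eq0 ?expr0n ?mul0r // oppr_le0.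
Qed.

Lemma dstep_le0 s : dstep s <= 0.
Proof.
rewrite /dstep mulNr oppr_le0 divr_ge0 ?sqr_ge0 // mulr_ge0 //.
by rewrite addr_ge0 // mulr_ge0 ?sqr_ge0 ?pos_part_ge0.
Qed.

Lemma dstep_eq0 s : ~~ (-1 < s < 0) -> dstep s = 0.
Proof.
rewrite negb_and -!leNgt => /orP[s1|s0]; rewrite /dstep /pos_sqr.
  by rewrite (@pos_part_eq0 (1 + s)) ?expr0n /=
     ?mulr0 ?addr0 ?mulr0 ?oppr0 ?mul0r //; lra.
by rewrite (@pos_part_eq0 (- s)) ?expr0n /=
   ?mul0r ?addr0 ?mulr0 ?oppr0 ?mul0r // oppr_le0.
Qed.

(** The shifts by 2 make the plateau [-1, 1] and the support [-2, 2]. *)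
Definition hat s : R := step (s - 2) * step (- s - 2).

(** The cubes of half-side r and 2 r are the closed balls of the sup norm, so
    that a product of one-variable cutoffs is adapted to them. *)
Definition cube_bump a r x : R := \prod_(i < 3) hat ((x 0 i - a 0 i) / r).

Lemma hat_ge0 s : 0 <= hat s.
Proof. by rewrite /hat mulr_ge0 ?step_ge0. Qed.

Lemma hat_le1 s : hat s <= 1.
Proof. by rewrite /hat mulr_ile1 ?step_ge0 ?step_le1. Qed.

Lemma hat1 s : `|s| <= 1 -> hat s = 1.
Proof.
rewrite ler_norml => /andP[h1 h2].
by rewrite /hat !step1 ?mulr1 //; lra.
Qed.

Lemma hat0 s : 2 <= `|s| -> hat s = 0.
Proof.
rewrite ler_normr => /orP[h|h]; rewrite /hat.
  by rewrite step0 ?mul0r //; lra.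
by rewrite [X in _ * X]step0 ?mulr0 //; lra.
Qed.

Lemma cube_bump_ge0 a r x : 0 <= cube_bump a r x.
Proof. by apply: prodr_ge0 => i _; exact: hat_ge0. Qed.

Lemma cube_bump_le1 a r x : cube_bump a r x <= 1.
Proof.
by apply: prodr_ile1 => i _; rewrite hat_ge0 hat_le1.
Qed.

Lemma cube_bump1 a r x : 0 < r -> `|x - a| <= r -> cube_bump a r x = 1.
Proof.
move=> r0 xa; apply: big1 => i _; apply: hat1.
rewrite normrM normfV (gtr0_norm r0) ler_pdivrMr // mul1r.
by have := norm_coord_le (x - a) i; rewrite !mxE => h; exact: le_trans xa.
Qed.

Lemma cube_bump0 a r x : 0 < r -> 2 * r < `|x - a| -> cube_bump a r x = 0.
Proof.
move=> r0 xa.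
have [i xi] : exists i, 2 * r < `|x 0 i - a 0 i|.
  apply: contrapT => /forallNP H; move: xa; apply/negP; rewrite -leNgt.
  apply: norm_le_coord => [|i]; first by rewrite mulr_ge0 // ltW.
  by rewrite !mxE leNgt; apply/negP; exact: H.
apply/eqP/prodf_eq0; exists i => //; apply/eqP/hat0.
by rewrite normrM normfV (gtr0_norm r0) ler_pdivlMr // ltW.
Qed.

Lemma C1_on_hat W a r i : open W ->
  C1_on W (fun x : space => hat ((x 0 i - a 0 i) / r)).
Proof.
move=> oW.
have ccst (c : R) : C1_on W (fun _ => c) by exact: C1_on_cst.
have cx : C1_on W (fun x : space => (x 0 i - a 0 i) / r).
  exact: (C1_onM oW (C1_onD oW (@C1_on_coord _ W i) (ccst _)) (ccst _)).
have cstep f : C1_on W f -> C1_on W (fun x => step (f x)).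
  exact: (C1_on_comp oW (@derivable_step) (@continuous_derive1_step)).
have c1 := cstep _ (C1_onD oW cx (ccst (- 2))).
have c2 := cstep _ (C1_onD oW (C1_onM oW (ccst (-1)) cx) (ccst (- 2))).
have := C1_onM oW c1 c2; congr (C1_on W _).
by apply/funext => x; rewrite /hat mulN1r.
Qed.

Lemma C1_on_prod W (I : Type) (l : seq I) (F : I -> space -> R) : open W ->
  (forall i, C1_on W (F i)) -> C1_on W (fun x => \prod_(i <- l) F i x).
Proof.
move=> oW cF; elim: l => [|i l IH].
  by under eq_fun do rewrite big_nil; exact: C1_on_cst.
by under eq_fun do rewrite big_cons; exact: (C1_onM oW (cF i) IH).
Qed.

Lemma C1_on_bump W a r : open W -> C1_on W (cube_bump a r).
Proof.
by move=> oW; exact: (C1_on_prod _ oW (fun i => C1_on_hat a r i oW)).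
Qed.

End Cutoff.

(** * Tangent fields near a regular boundary point *)

Section Local.
Variable R : realType.
Local Notation space := 'rV[R]_3.
Local Notation e_ i := (basis_vec R i).
Local Notation volume := (@volume R).
Local Notation line := (measurableTypeR R).
Local Notation coords := (@of_coords R : line * line * line -> space).
Implicit Types (f g : space -> R) (x y : space) (K W : set space).

Lemma vint_cvg (f_ : nat -> space -> R) f g :
  (forall n, tame (f_ n)) -> tame f -> tame g ->
  (forall n x, `|f_ n x| <= g x) -> (forall x, f_ ^~ x @ \oo --> f x) ->
  vint (f_ n) @[n --> \oo] --> vint f.
Proof.
move=> tf_ tf tg f_g f_f.
have mE h : tame h -> measurable_fun setT (fun p => (h (coords p))%:E).
  by case=> mh _; exact/measurable_EFinP.
have := @dominated_cvg _ _ R volume setT measurableT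
  (fun n p => (f_ n (coords p))%:E) (fun p => (f (coords p))%:E)
  (fun p => (g (coords p))%:E) (fun n => mE _ (tf_ n))
  (fun p _ => _) (fun p _ => isT) (tame_integrable tg) (fun n p _ => _).
move=> H; have {}H := H _ _.
have fE h : tame h ->
    (vint h)%:E = (\int[volume]_p (h (coords p))%:E)%E.
  by move=> th; rewrite /vint /Rintegral fineK //;
    exact: integrable_fin_num (tame_integrable th).
apply: fine_cvg; rewrite fE //; apply: H => [p|n p].
  by apply: cvg_EFin; [exact: nearW|exact: f_f].
by rewrite abse_EFin lee_fin.
Qed.

Lemma cube_closed x r : closed [set y : space | `|y - x| <= r].
Proof.
have := @closed_comp _ _ (fun y : space => `|y - x|) [set z : R | z <= r].
apply; last exact: closed_le.
move=> y _; apply: (continuous_comp (f := fun y => y - x)).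
  by apply: (@continuousB _ _ _ id (cst x)) => //; exact: cst_continuous.
exact: norm_continuous.
Qed.

Lemma cube_compact x r : compact [set y : space | `|y - x| <= r].
Proof.
apply: bounded_closed_compact; last exact: cube_closed.
exists (r + `|x|); split; first exact: num_real.
move=> N rN y /= yx; apply/ltW; apply: le_lt_trans rN.
by rewrite -(subrK x y) (le_trans (ler_normD _ _)) // lerD2r.
Qed.

Lemma cube_compact_support x r f : (forall y, ~ `|y - x| <= r -> f y = 0) ->
  forall y, r + `|x| < `|y| -> f y = 0.
Proof.
move=> f0 y ry; apply: f0 => yx.
by have := ler_normD (y - x) x; rewrite subrK; lra.
Qed.

Lemma continuous_glue W K f : open W -> closed K -> K `<=` W ->
  (forall x, W x -> {for x, continuous f}) -> (forall x, ~ K x -> f x = 0) ->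
  continuous f.
Proof.
move=> oW cK KW cf f0 x; have [Kx|Kx] := pselect (K x); first exact/cf/KW.
apply: (@continuous_for_near _ f (fun _ => 0)); last exact: continuous_cst.
near=> z; apply: f0; suff : (~` K) z by [].
by near: z; apply: open_nbhs_nbhs; split => //; exact: closed_openC.
Unshelve. all: by end_near.
Qed.

(** The divergence of the field g H. The components of H are separate scalar
    functions because the calculus above is that of scalar functions. *)
Definition divg (H : 'I_3 -> space -> R) g x : R :=
  \sum_i 'D_(e_ i) (fun y => g y * H i y) x.

Lemma vint_div_compact (F : 'I_3 -> space -> R) x r :
  (forall i, C1_on setT (F i)) ->
  (forall i y, ~ `|y - x| <= r -> F i y = 0) ->
  tame (fun y => \sum_i 'D_(e_ i) (F i) y) /\
  vint (fun y => \sum_i 'D_(e_ i) (F i) y) = 0.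
Proof.
move=> cF F0.
have F0' i := @cube_compact_support x r (F i) (F0 i).
have dF i y : derivable (F i) y (e_ i).
  by apply: diff_derivable; have [] := cF i y I.
have cDF i : continuous ('D_(e_ i) (F i)) by move=> y; have [_ h] := cF i y I; exact: h.
have tF i : tame ('D_(e_ i) (F i)) by exact: tame_derive (F0' i).
split; first exact: tame_sum.
by rewrite vint_sum // big1 // => i _; exact: vint_derive (F0' i).
Qed.

(** The continuous function |phi| + max (0, e - |q|) has no zero on K, so its
    minimum d over K is positive; where |phi| < d the second term is positive.
*)
Lemma small_near_zero_set K (phi q : space -> R) (e : R) : compact K ->
  (forall x, K x -> {for x, continuous phi}) ->
  (forall x, K x -> {for x, continuous q}) ->
  (forall x, K x -> phi x = 0 -> q x = 0) -> 0 < e ->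
  exists2 d, 0 < d & forall x, K x -> `|phi x| < d -> `|q x| <= e.
Proof.
move=> cK cphi cq q0 e0.
have [->|/set0P[x0 Kx0]] := eqVneq K set0; first by exists 1.
pose m x := `|phi x| + Num.max 0 (e - `|q x|).
have cm : {within K, continuous m}.
  apply: continuous_in_subspaceT => x /set_mem Kx.
  apply: continuous_add.
    by apply: (continuous_comp1 (h := Num.norm)); [exact: cphi|exact: norm_continuous].
  apply: (@continuous_max _ _ (fun _ => 0) (fun x => e - `|q x|)).
    exact: continuous_cst.
  apply: (continuous_add (f := fun _ => e)); first exact: continuous_cst.
  apply: continuous_opp.
  by apply: (continuous_comp1 (h := Num.norm)); [exact: cq|exact: norm_continuous].
have [z /set_mem Kz mz] := compact_EVT_min (ex_intro _ x0 Kx0) cK cm.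
exists (m z).
  rewrite /m; have [z0|z0] := eqVneq (phi z) 0.
    by rewrite q0 // normr0 subr0 ltr_wpDl // lt_max e0 orbT.
  by rewrite ltr_pwDl ?normr_gt0 // le_max lexx.
move=> x Kx; apply: contraTT; rewrite -ltNge -leNgt => ex.
have := mz x (mem_set Kx); rewrite {2}/m max_l ?addr0 //.
by rewrite subr_le0 ltW.
Qed.

Section Flux.
Variables (V W : set space) (H : 'I_3 -> space -> R).
Hypothesis oV : open V.
Hypothesis bV : bounded_set V.
Hypothesis oW : open W.
Hypothesis VW : closure V `<=` W.
Hypothesis cH : forall i, C1_on W (H i).
Hypothesis tangentH : forall x nu, boundary V x -> outward_unit_normal V x nu ->
  \sum_i H i x * nu 0 i = 0.

(** The integral over V of div (g H); it equals the flux of g H through the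
    boundary, which vanishes for tangent H whatever g is. *)
Definition int_div g : R := vint (divg H g \_ V).

Lemma continuous_divg U g : open U -> U `<=` W -> C1_on U g ->
  forall x, U x -> {for x, continuous (divg H g)}.
Proof.
move=> oU UW cg x Ux; apply: continuous_sum => i.
have := C1_onM oU cg (C1_on_sub UW (cH i)).
by move=> /(_ x Ux)[_ h]; exact: h.
Qed.

Lemma tame_divg g : C1_on setT g -> tame (divg H g \_ V).
Proof.
move=> cg; apply: tame_patch => // x /VW; apply: continuous_divg => //.
exact: C1_on_sub cg.
Qed.

Lemma divgD g h x : C1_on setT g -> C1_on setT h -> W x ->
  divg H (fun y => g y + h y) x = divg H g x + divg H h x.
Proof.
move=> cg ch Wx; rewrite /divg -big_split /=; apply: eq_bigr => i _.
have [dg _] := cg x I; have [dh _] := ch x I; have [dH _] := cH i Wx.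
rewrite -derive_add; try exact: differentiableM.
by congr ('D_(_) _ x); apply/funext => y; rewrite mulrDl.
Qed.

Lemma int_divD g h : C1_on setT g -> C1_on setT h ->
  int_div (fun y => g y + h y) = int_div g + int_div h.
Proof.
move=> cg ch; rewrite /int_div -vintD; try exact: tame_divg.
congr vint; apply/funext => x; rewrite !patchE; case: ifPn => [/set_mem Vx|_].
  by rewrite divgD //; apply/VW/subset_closure.
by rewrite addr0.
Qed.

(** H is differentiable only on W, but the product with a cutoff supported in
    a cube inside W is a field on the whole space. *)
Lemma C1_on_cutoff_mul U x r g i : open U -> U `<=` W ->
  [set y | `|y - x| <= r] `<=` U -> C1_on U g ->
  (forall y, ~ `|y - x| <= r -> g y = 0) ->
  C1_on setT (fun y => g y * H i y).
Proof.
move=> oU UW KU cg g0.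
apply: (C1_on_glue oU (@cube_closed x r) KU).
  exact: (C1_onM oU cg (C1_on_sub UW (cH i))).
by move=> y /g0 ->; rewrite mul0r.
Qed.

(** The local form of the divergence theorem. The factor g leaves room for the
    other cutoffs in a product, which turns a finite cover by cubes into a
    partition of the field. *)
Definition cutoff_vanishing x r := forall g, C1_on setT g ->
  (forall y, 0 <= g y) -> int_div (fun y => g y * cube_bump x r y) = 0.

Lemma cube_bump_off x r y : 0 < r -> ~ `|y - x| <= 2 * r -> cube_bump x r y = 0.
Proof. by move=> r0 /negP; rewrite -ltNge => h; exact: cube_bump0. Qed.

(** If the cube lies in V, div (g H) over V is its integral over the whole
    space. *)
Lemma cutoff_vanishing_interior x : V x -> exists2 r, 0 < r & cutoff_vanishing x r.
Proof.
move=> Vx.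
have /nbhs_ballP[e /= e0 xe] : nbhs x V by exact: open_nbhs_nbhs.
exists (e / 4) => [|g cg g0]; first by rewrite divr_gt0.
set r := e / 4; have r0 : 0 < r by rewrite divr_gt0.
have KV : [set y | `|y - x| <= 2 * r] `<=` V.
  move=> y /= yx; apply: xe; rewrite mx_norm_ball /ball_ /= distrC.
  by apply: le_lt_trans yx _; rewrite /r; lra.
have VW' : V `<=` W by move=> y /subset_closure/VW.
pose F i y := (g y * cube_bump x r y) * H i y.
have F0 i y : ~ `|y - x| <= 2 * r -> F i y = 0.
  by move=> yx; rewrite /F cube_bump_off // mulr0 mul0r.
have cgb : C1_on setT (fun y => g y * cube_bump x r y).
  exact: (C1_onM openT cg (C1_on_bump x r openT)).
have cF i : C1_on setT (F i).
  apply: (C1_on_cutoff_mul i oV VW' KV (C1_on_sub (@subsetT _ V) cgb)) => y yx.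
  by rewrite cube_bump_off // mulr0.
rewrite /int_div -[RHS](vint_div_compact cF F0).2; congr vint.
apply/funext => y; rewrite patchE; case: ifPn => // /negP yV.
apply/esym/big1 => i _.
apply: (@derive_off_closed _ _ (F i) _ y (@cube_closed x (2 * r)) (F0 i)).
by move=> /KV Vy; apply: yV; exact/mem_set.
Qed.

(** A cube in which V is {phi < 0}, and a coordinate in which phi is strictly
    monotone, increasing or decreasing according to the sign sg. *)
Section AtSmoothBoundaryPoint.
Variables (x : space) (O : set space) (phi : space -> R) (i : 'I_3).
Variables (r c sg : R).
Hypothesis c0 : 0 < c.
Hypothesis sg1 : sg * sg = 1.
Hypothesis oO : open O.
Hypothesis OW : O `<=` W.
Hypothesis cphi : C1_on O phi.
Hypothesis Vphi : forall y, O y -> (V y <-> phi y < 0).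
Hypothesis dphi : forall y, O y -> c <= sg * 'D_(e_ i) phi y.
Hypothesis KO : [set y | `|y - x| <= 2 * r] `<=` O.

Let sgn : `|sg| = 1.
Proof.
by apply/eqP; rewrite -(@eqrXn2 _ 2) // ?expr1n -?normrX ?expr2 ?sg1 ?normr1.
Qed.

Let K : set space := [set y | `|y - x| <= 2 * r].
Let q y : R := \sum_j H j y * 'D_(e_ j) phi y.

(** Zeros of phi are limits of points of V, because phi becomes negative when
    one moves from them by a little in the direction -sg e_i. *)
Lemma zero_boundary y : O y -> phi y = 0 -> boundary V y.
Proof.
move=> Oy y0; split; last first.
  move=> /interior_subset /(Vphi Oy); by rewrite y0 ltxx.
move=> B By.
have [dphiy _] := cphi Oy.
have dq : (fun h : R => sg * (h^-1 *: ((phi \o shift y) (h *: e_ i) - phi y)))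
    @ 0^' --> sg * 'D_(e_ i) phi y.
  apply: cvgM; first exact: cvg_cst.
  exact: (diff_derivable dphiy).
have P1 : \forall h \near 0^',
    0 < sg * (h^-1 *: ((phi \o shift y) (h *: e_ i) - phi y)).
  by apply: (cvgr_gt _ dq); apply: lt_le_trans c0 (dphi Oy).
have P2 : \forall h \near (0 : R)^', (B `&` O) (h *: e_ i + y).
  apply: nbhs_dnbhs.
  have : (h *: e_ i + y) @[h --> (0 : R)] --> y.
    have -> : nbhs y = nbhs (0 *: e_ i + y) by rewrite scale0r add0r.
    by apply: cvgD; [apply: cvgZr_tmp; exact: cvg_id|exact: cvg_cst].
  by apply; apply: filterI => //; exact: open_nbhs_nbhs.
have : \forall h \near (0 : R)^',
   [/\ 0 < sg * (h^-1 *: ((phi \o shift y) (h *: e_ i) - phi y))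
   & (B `&` O) (h *: e_ i + y)].
  by apply: filterS2 P1 P2 => h.
move=> /nbhs_ballP[d /= d0 hd].
pose h := - sg * (d / 2).
have sgn0 : sg != 0 by apply: contra_eq_neq sg1 => ->; rewrite mul0r eq_sym oner_neq0.
have h0 : h != 0 by rewrite mulf_neq0 ?oppr_eq0 // gt_eqF // divr_gt0.
have [] := hd h _ h0.
  rewrite /ball /= sub0r normrN /h normrM normrN sgn mul1r gtr0_norm ?divr_gt0 //.
  by rewrite ltr_pdivrMr // ltr_pMr // ltr1n.
rewrite /= y0 subr0 -[_ *: _]/(_ * _) => P [PB PO].
exists (h *: e_ i + y); split => //; apply/(Vphi PO).
have hi : sg * h^-1 = - (d / 2)^-1.
  by rewrite /h; field; rewrite sgn0 gt_eqF.
by move: P; rewrite mulrA hi mulNr oppr_gt0 pmulr_rlt0 // invr_gt0 divr_gt0.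
Qed.

(** Every zero of phi is a regular boundary point, with normal along grad phi,
    not only the centre of the cube. *)
Lemma tangent_zero y : O y -> phi y = 0 -> q y = 0.
Proof.
move=> Oy y0.
have gi : (grad phi y) 0 i != 0.
  rewrite mxE; apply/eqP => e0; have := dphi Oy.
  by rewrite e0 mulr0 leNgt c0.
have g0 : grad phi y != 0 by apply: contra_neq gi => ->; rewrite mxE.
have dg : 0 < dot (grad phi y) (grad phi y).
  rewrite /dot (bigD1 i) //= ltr_pwDl //.
    by rewrite -expr2 exprn_even_gt0.
  by apply: sumr_ge0 => j _; rewrite -expr2 sqr_ge0.
have on : outward_unit_normal V y
    ((Num.sqrt (dot (grad phi y) (grad phi y)))^-1 *: grad phi y).
  by exists O, phi; split; split.
have := tangentH (zero_boundary Oy y0) on.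
under eq_bigr do rewrite !mxE mulrCA.
rewrite -mulr_sumr => /eqP; rewrite mulf_eq0 invr_eq0 gt_eqF ?sqrtr_gt0 //=.
by move=> /eqP.
Qed.

Section Limit.
Variable h : space -> R.
Hypothesis ch : C1_on setT h.
Hypothesis h_ge0 : forall y, 0 <= h y.
Hypothesis h_off : forall y, ~ K y -> h y = 0.

(** chi n tends to the indicator of V in the cube; A and B are the two terms of
    the product rule for div (h chi_n H). The index is n + 1 to avoid a
    constant chi. *)
Let chi (n : nat) y : R := step (n.+1%:R * phi y).
Let A n y : R := chi n y * divg H h y.
Let B n y : R := h y * (n.+1%:R * dstep (n.+1%:R * phi y)) * q y.

Lemma chi_norm_le1 n y : `|chi n y| <= 1.
Proof. by rewrite ger0_norm; [exact: step_le1|exact: step_ge0]. Qed.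

Lemma C1_on_chi n : C1_on O (chi n).
Proof.
apply: (C1_on_comp oO (@derivable_step R) (@continuous_derive1_step R)).
exact: (C1_onM oO (@C1_on_cst _ O _) cphi).
Qed.

Lemma derive_chi n j y : O y -> 'D_(e_ j) (chi n) y =
  n.+1%:R * dstep (n.+1%:R * phi y) * 'D_(e_ j) phi y.
Proof.
move=> Oy; have [dp _] := cphi Oy.
rewrite derive_comp1; last 2 first.
- exact: derivable_step.
- by apply: differentiableM => //; exact: differentiable_cst.
rewrite derive1_step derive_mul //.
by rewrite derive_cst mulr0 addr0; ring.
Qed.

Lemma C1_on_hchi n : C1_on setT (fun y => h y * chi n y).
Proof.
apply: (C1_on_glue oO (@cube_closed x (2 * r)) KO).
  exact: (C1_onM oO (C1_on_sub (@subsetT _ O) ch) (@C1_on_chi n)).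
by move=> y /h_off ->; rewrite mul0r.
Qed.

Lemma hchi_off n y : ~ K y -> h y * chi n y = 0.
Proof. by move=> /h_off ->; rewrite mul0r. Qed.

Lemma divg_hchi n y : divg H (fun y => h y * chi n y) y = A n y + B n y.
Proof.
have cK : closed K by exact: cube_closed.
have [Ky|Ky] := pselect (K y); last first.
  rewrite /A /B /divg h_off // !mul0r addr0 !big1 ?mulr0 // => j _.
    by apply: (@derive_off_closed _ _ _ _ y cK) => // z /h_off ->; rewrite mul0r.
  by apply: (@derive_off_closed _ _ _ _ y cK) => // z /(hchi_off n) ->; rewrite mul0r.
have Oy := KO Ky.
have [dh _] := @ch y I; have [dp _] := cphi Oy; have [dc _] := C1_on_chi n Oy.
rewrite /A /B /divg /q !mulr_sumr -big_split /=; apply: eq_bigr => j _.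
have [dH _] := cH j (OW Oy).
rewrite derive_mul //; last exact: differentiableM.
by rewrite (derive_mul (e_ j) dh dc) (derive_mul (e_ j) dh dH) derive_chi //; ring.
Qed.

Lemma vint_hchi n : tame (divg H (fun y => h y * chi n y)) /\
  vint (divg H (fun y => h y * chi n y)) = 0.
Proof.
apply: (@vint_div_compact _ x (2 * r)) => [j|j y /(hchi_off n) ->].
  apply: (C1_on_cutoff_mul j oO OW KO (C1_on_sub (@subsetT _ O) (@C1_on_hchi n))).
  exact: hchi_off.
by rewrite mul0r.
Qed.

Lemma tame_chi_mul n f : (forall y, O y -> {for y, continuous f}) ->
  (forall y, ~ K y -> f y = 0) -> tame (fun y => chi n y * f y).
Proof.
move=> cf f0.
have ff y : ~ K y -> chi n y * f y = 0 by move=> /f0 ->; rewrite mulr0.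
apply: (continuous_tame (M := 2 * r + `|x|)); last exact: cube_compact_support.
apply: (continuous_glue oO (@cube_closed x (2 * r)) KO) => // y Oy.
apply: continuous_mul; last exact: cf.
exact: C1_on_continuous (@C1_on_chi n) Oy.
Qed.

Lemma divg_off y : ~ K y -> divg H h y = 0.
Proof.
move=> Ky; apply: big1 => j _.
apply: (@derive_off_closed _ _ _ _ y (@cube_closed x (2 * r))) => // z /h_off ->.
by rewrite mul0r.
Qed.

Lemma tame_A n : tame (A n).
Proof.
apply: tame_chi_mul; last exact: divg_off.
exact: (continuous_divg oO OW (C1_on_sub (@subsetT _ O) ch)).
Qed.

Lemma tame_B n : tame (B n).
Proof.
have [t _] := vint_hchi n.
have := tameD t (tameN (tame_A n)); congr tame.
by apply/funext => y; rewrite divg_hchi addrC addKr.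
Qed.

Lemma vint_A n : vint (A n) = - vint (B n).
Proof.
have [t v] := vint_hchi n.
apply/eqP; rewrite -addr_eq0 -vintD //; [|exact: tame_A|exact: tame_B].
by rewrite -v; apply/eqP; congr vint; apply/funext => y; rewrite divg_hchi.
Qed.

(** B n lives where -1/(n+1) < phi < 0, so there |q| <= e for large n, since q
    vanishes with phi. The other factor h (n+1) |dstep| is at most
    - sg h d_i(chi_n) / c, because sg d_i(phi) >= c. Finally
    - h d_i(chi_n) = chi_n d_i(h) - d_i(h chi_n), where the last term has
    integral zero and 0 <= chi_n <= 1. *)
Lemma vint_B_small e : 0 < e ->
  \forall n \near \oo, `|vint (B n)| <= e / c * vint (fun y => `|'D_(e_ i) h y|).
Proof.
move=> e0.
have cq y : K y -> {for y, continuous q}.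
  move=> /KO Oy; apply: continuous_sum => j; apply: continuous_mul.
    exact: C1_on_continuous (cH j) (OW Oy).
  by have [_ k] := cphi Oy; exact: k.
have cp y : K y -> {for y, continuous phi}.
  by move=> /KO; exact: C1_on_continuous cphi.
have [d d0 small] := @small_near_zero_set K phi q e (@cube_compact x (2 * r))
  cp cq (fun y Ky => tangent_zero (KO Ky)) e0.
exists (Num.truncn d^-1) => // n /= dn.
have nd : n.+1%:R^-1 < d.
  rewrite -[d]invrK ltf_pV2 ?posrE ?invr_gt0 //.
  by apply: lt_le_trans (truncnS_gt _) _; rewrite ler_nat.
pose G y := 'D_(e_ i) (fun y => h y * chi n y) y.
have [tG vG] : tame G /\ vint G = 0.
  have cG := @C1_on_hchi n.
  have dG y : derivable (fun y => h y * chi n y) y (e_ i).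
    by apply: diff_derivable; have [] := cG y I.
  have cDG : continuous ('D_(e_ i) (fun y => h y * chi n y)).
    by move=> y; have [_ k] := cG y I; exact: k.
  have G0 := @cube_compact_support x (2 * r) _ (hchi_off n).
  by split; [exact: tame_derive cDG G0|exact: vint_derive dG cDG G0].
have cDh : continuous ('D_(e_ i) h) by move=> y; have [_ k] := @ch y I; exact: k.
have tDh : tame (fun y => `|'D_(e_ i) h y|).
  apply: tame_norm; apply: tame_derive cDh _.
  exact: (@cube_compact_support x (2 * r) _ h_off).
apply: le_trans (norm_vint_le (tame_B n)) _.
pose U y := e / c * (`|'D_(e_ i) h y| + - sg * G y).
have tU : tame U by apply: tameZ; apply: tameD => //; exact: tameZ.
apply: le_trans (_ : vint U <= _).
  apply: le_vint => //; first exact: tame_norm (tame_B n).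
  move=> y; rewrite /U; have [Ky|Ky] := pselect (K y); last first.
    rewrite /B h_off // !mul0r normr0 mulr_ge0 ?divr_ge0 ?(ltW e0) ?(ltW c0) //.
    have -> : G y = 0.
      by apply: (@derive_off_closed _ _ _ _ y (@cube_closed x (2 * r)))
        => // z /(hchi_off n).
    by rewrite mulr0 addr0.
  have Oy := KO Ky; have [dh _] := @ch y I; have [dc _] := C1_on_chi n Oy.
  pose w := n.+1%:R * dstep (n.+1%:R * phi y).
  have w0 : 0 <= h y * - w.
    apply: mulr_ge0 => //; rewrite oppr_ge0; apply: mulr_ge0_le0 => //.
    exact: dstep_le0.
  have Bw : `|B n y| <= e * (h y * - w).
    rewrite /B -/w normrM -[X in X * _]normrN -mulrN (ger0_norm w0) mulrC.
    have [nphi|nphi] := boolP (-1 < n.+1%:R * phi y < 0); last first.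
      by rewrite /w dstep_eq0 // !mulr0 oppr0 !mulr0.
    apply: ler_wpM2r => //; apply: small => //; apply: lt_trans nd.
    rewrite -[ltRHS]mul1r ltr_pdivlMr // mulrC -(ger0_norm (ler0n R n.+1)) -normrM.
    by move: nphi => /andP[p1 p2]; rewrite ltr_norml p1 (lt_trans p2).
  apply: le_trans Bw _; rewrite mulrAC -mulrA ler_wpM2l ?(ltW e0) // mulrC.
  rewrite ler_pdivlMr //.
  apply: le_trans (_ : h y * - w * (sg * 'D_(e_ i) phi y) <= _).
    by rewrite [- w * h y]mulrC; apply: ler_wpM2l => //; exact: dphi.
  have -> : G y = h y * (w * 'D_(e_ i) phi y) + chi n y * 'D_(e_ i) h y.
    by rewrite /G derive_mul // derive_chi // /w.
  have sgc : sg * (chi n y * 'D_(e_ i) h y) <= `|'D_(e_ i) h y|.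
    apply: le_trans (ler_norm _) _; rewrite normrM sgn mul1r normrM.
    by apply: ler_piMl => //; exact: chi_norm_le1.
  nra.
rewrite /U vintZ; last by apply: tameD => //; exact: tameZ.
by rewrite vintD ?vintZ ?vG ?mulr0 ?addr0 //; exact: tameZ.
Qed.

(** By dominated convergence the integrals of A n = chi_n div (h H) tend to the
    integral over V, while they equal those of - B n, which tend to 0. *)
Lemma int_div_limit : int_div h = 0.
Proof.
have tV : tame (divg H h \_ V) by exact: tame_divg.
have tD : tame (divg H h).
  apply: (@vint_div_compact (fun j y => h y * H j y) x (2 * r) _ _).1.
    move=> j.
    exact: (C1_on_cutoff_mul j oO OW KO (C1_on_sub (@subsetT _ O) ch) h_off).
  by move=> j y /h_off ->; rewrite mul0r.
have AV : vint (A n) @[n --> \oo] --> int_div h.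
  apply: (vint_cvg (@tame_A) tV (tame_norm tD)) => [n y|y].
    by rewrite /A normrM; apply: ler_piMl => //; exact: chi_norm_le1.
  rewrite patchE.
  have [Ky|Ky] := pselect (K y); last first.
    rewrite /A divg_off // if_same; under eq_fun do rewrite mulr0.
    exact: cvg_cst.
  case: ifPn => [/set_mem /(Vphi (KO Ky)) p0|/negP yV].
    apply: cvg_near_cst; exists (Num.truncn (- (phi y))^-1) => // n /= pn.
    rewrite /A /chi step1 ?mul1r //.
    have p0' : 0 < - phi y by rewrite oppr_gt0.
    rewrite lerNr -mulrN -ler_pdivrMr // div1r.
    apply/ltW; apply: lt_le_trans (truncnS_gt _) _.
    by rewrite ler_nat.
  rewrite /A /chi; have p0 : 0 <= phi y.
    rewrite leNgt; apply/negP => /(Vphi (KO Ky)) Vy; apply: yV; exact/mem_set.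
  under eq_fun do rewrite step0 ?mulr_ge0 // mul0r.
  exact: cvg_cst.
pose T := vint (fun y => `|'D_(e_ i) h y|).
have T0 : 0 <= T by apply: Rintegral_ge0.
have A0 : vint (A n) @[n --> \oo] --> (0 : R).
  apply/cvgrPdist_le => e e0.
  (* T + 1 instead of T, which may be zero *)
  have e1 : 0 < e * c / (T + 1) by rewrite divr_gt0 ?mulr_gt0 // ltr_wpDl.
  apply: filterS (vint_B_small e1) => n; rewrite -/T sub0r normrN vint_A normrN.
  move=> h1; apply: le_trans h1 _.
  rewrite (_ : _ * T = e * (T / (T + 1))); last by field; rewrite !gt_eqF // ltr_wpDl.
  rewrite ler_piMr ?(ltW e0) // ler_pdivrMr ?ltr_wpDl // mul1r lerDl //.
exact: (cvg_unique _ AV A0).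
Qed.

End Limit.

End AtSmoothBoundaryPoint.

(** Some partial derivative of phi is non-zero at x, and by continuity it keeps
    its sign and half of its size in a ball. A quarter of the radius makes the
    cube of half-side 2 r fit in. *)
Lemma cutoff_vanishing_boundary x nu :
  closure V x -> outward_unit_normal V x nu ->
  exists2 r, 0 < r & cutoff_vanishing x r.
Proof.
move=> Vx [U [phi [[oU Ux cphi Vphi] [phix gx _]]]].
have [i gi] : exists i, 'D_(e_ i) phi x != 0.
  apply: contrapT => /forallNP G; move/eqP: gx; apply; apply/rowP => i.
  by rewrite !mxE; apply/eqP; have /negP := G i; rewrite negbK.
pose sg := Num.sg ('D_(e_ i) phi x); pose c := `|'D_(e_ i) phi x| / 2.
have sg1 : sg * sg = 1 by rewrite -expr2 sqr_sg gi.
have c0 : 0 < c by rewrite divr_gt0 ?normr_gt0.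
have [_ cD] := cphi x Ux.
have near_dphi : \forall y \near x, c < sg * 'D_(e_ i) phi y.
  have : sg * 'D_(e_ i) phi y @[y --> x] --> sg * 'D_(e_ i) phi x.
    exact: (continuous_mul (@continuous_cst _ sg x) (cD i)).
  move/cvgr_gt; apply; rewrite /sg -normrEsg /c.
  by rewrite ltr_pdivrMr // ltr_pMr ?normr_gt0 // ltr1n.
have : nbhs x (U `&` W `&` [set y | c < sg * 'D_(e_ i) phi y]).
  apply: filterI => //; apply: filterI; first exact: open_nbhs_nbhs.
  by apply: open_nbhs_nbhs; split => //; exact: VW.
move=> /nbhs_ballP[e /= e0 xe].
have KO : [set y | `|y - x| <= 2 * (e / 4)] `<=` ball x e.
  move=> y /= yx; rewrite mx_norm_ball /ball_ /= distrC.
  by apply: le_lt_trans yx _; lra.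
have r0 : 0 < e / 4 by rewrite divr_gt0.
exists (e / 4) => // g cg g0.
apply: (@int_div_limit x (ball x e) phi i (e / 4) c sg).
- exact: c0.
- exact: sg1.
- exact: ball_open.
- by move=> y /xe[[_ ?] _].
- by apply: C1_on_sub cphi => y /xe[[? _] _].
- by move=> y /xe[[Uy _] _]; exact: Vphi.
- by move=> y /xe[_ /= /ltW].
- exact: KO.
- exact: (C1_onM openT cg (C1_on_bump x (e / 4) openT)).
- by move=> y; rewrite mulr_ge0 ?cube_bump_ge0.
- by move=> y /= yx; rewrite cube_bump_off // mulr0.
Qed.

End Flux.

End Local.

(** * Tangent fields and negligible edges *)

Section CoverOfArcs.
Variable R : realType.
Local Notation space := 'rV[R]_3.

(** The mean value theorem in each coordinate: for the sup norm no constant is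
    lost. *)
Lemma C1_curve_lipschitz (c : R -> space) : C1_curve c ->
  exists M, 0 <= M /\ forall s t, 0 <= s <= 1 -> 0 <= t <= 1 ->
    `|c s - c t| <= M * `|s - t|.
Proof.
move=> [dc cc].
have cn : {within `[(0 : R), 1], continuous (fun r => `|derive1 c r|)}.
  apply: continuous_subspaceT => r; apply: continuous_comp; first exact: cc.
  exact: norm_continuous.
have [z z01 zM] := EVT_max ler01 cn.
exists `|derive1 c z|; split => // s t.
wlog ts : s t / t <= s.
  move=> H hs ht; have [ts|st] := leP t s; first exact: H.
  by rewrite distrC (distrC s); apply: H => //; exact: ltW.
move=> /andP[s0 s1] /andP[t0 t1].
apply: norm_le_coord => [|j]; first by rewrite mulr_ge0.
have dj r : is_derive r (1 : R) (fun u => c u 0 j) ((derive1 c r) 0 j).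
  have dcj : derivable (fun u => c u 0 j) r 1.
    exact: ((derivable_mxP _ _ _).1 (dc r) 0 j).
  by apply: DeriveDef => //; rewrite derive1E derive_mx // mxE.
have cj : {within `[t, s], continuous (fun u => c u 0 j)}.
  by apply: derivable_within_continuous => r _;
    exact: (@ex_derive _ _ _ _ _ _ _ (dj r)).
have [d dts cst] : exists2 d, d \in `[t, s] &
    c s 0 j - c t 0 j = (derive1 c d) 0 j * (s - t).
  exact: (MVT_segment ts (fun r _ => dj r) cj).
rewrite !mxE cst normrM ler_wpM2r //; apply: le_trans (norm_coord_le _ _) _.
apply: zM; move: dts; rewrite !in_itv /= => /andP[h1 h2].
by rewrite (le_trans t0) // (le_trans h2).
Qed.

(** The points at the n + 2 parameters k / (n + 1), 0 <= k <= n + 1, of each arc.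
    The sum of the Lipschitz constants is a common one, and adding 1 makes the
    inequality strict. *)
Lemma arcs_cover m (c : 'I_m -> R -> space) : (forall j, C1_curve (c j)) ->
  exists2 M, 0 < M & forall n, exists2 ps : seq space,
    size ps = (m * n.+2)%N &
    forall j s, 0 <= s <= 1 -> exists2 p, p \in ps & `|c j s - p| < M / n.+1%:R.
Proof.
move=> cc.
have [M0 M0P] := choice (fun j => C1_curve_lipschitz (cc j)).
pose M := \sum_j M0 j + 1.
have M00 j : 0 <= M0 j by have [] := M0P j.
exists M => [|n]; first by rewrite ltr_wpDl ?sumr_ge0.
exists [seq c j (k%:R / n.+1%:R) | j <- enum 'I_m, k <- iota 0 n.+2].
  by rewrite size_allpairs size_enum_ord size_iota.
move=> j s /andP[s0 s1]; pose k := Num.truncn (s * n.+1%:R).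
have sn0 : 0 <= s * n.+1%:R by rewrite mulr_ge0.
have /andP[k1 k2] := truncn_itv sn0.
have kn : (k <= n.+1)%N.
  by rewrite -(ler_nat R); apply: le_trans k1 _; rewrite ler_piMl.
exists (c j (k%:R / n.+1%:R)).
  by apply/allpairsP; exists (j, k); rewrite mem_enum mem_iota /= add0n ltnS.
have [_ lip] := M0P j.
apply: le_lt_trans (lip _ _ _ _) _; first by rewrite s0.
  by rewrite divr_ge0 //= ler_pdivrMr // mul1r ler_nat.
have d : `|s - k%:R / n.+1%:R| <= n.+1%:R^-1.
  rewrite ger0_norm; last by rewrite subr_ge0 ler_pdivrMr.
  rewrite lerBlDr -[X in X + _]mul1r -mulrDl ler_pdivlMr //.
  by rewrite [1 + _]addrC natr1 ltW.
apply: le_lt_trans (ler_wpM2l (M00 j) d) _.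
rewrite ltr_pM2r ?invr_gt0 // /M (bigD1 j) //= -addrA ltrDl.
by rewrite ltr_wpDl // sumr_ge0.
Qed.

End CoverOfArcs.

Section DivergenceTheorem.
Variable R : realType.
Local Notation space := 'rV[R]_3.
Local Notation e_ i := (basis_vec R i).
Implicit Types (f g : space -> R) (x y p : space) (ps : seq space).

(** All the cutoffs are translates and dilates of one, so a single bound of its
    derivatives serves for all of them. *)
Lemma derive_bump_scale p (r : R) i x : r != 0 ->
  'D_(e_ i) (cube_bump p r) x =
  r^-1 * 'D_(e_ i) (cube_bump 0 1) (r^-1 *: (x - p)).
Proof.
move=> r0.
have bE : cube_bump p r = cube_bump 0 1 \o (fun y => r^-1 *: (y - p)).
  apply/funext => y; rewrite /cube_bump /=; apply: eq_bigr => j _.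
  by rewrite !mxE subr0 divr1 mulrC.
have dA : differentiable (fun y => r^-1 *: (y - p)) x.
  have := @differentiableZ R _ _ (fun y => y - p) r^-1 x; apply.
  exact: (@differentiableB R space space id (cst p) x).
have db : differentiable (cube_bump 0 1) (r^-1 *: (x - p)).
  by have [] := @C1_on_bump R setT 0 1 openT (r^-1 *: (x - p)) I.
rewrite bE deriveE; last exact: differentiable_comp.
rewrite diff_comp //= -deriveE // (_ : 'd _ x (e_ i) = r^-1 *: e_ i).
  by rewrite deriveE // linearZ -deriveE.
rewrite -deriveE //.
have := @deriveZ R _ _ (fun y => y - p) r^-1 x (e_ i).
rewrite (@deriveB R space space id (cst p)) // derive_id derive_cst subr0.
by apply; apply: diff_derivable; exact: (@differentiableB R space space id (cst p) x).
Qed.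

(** The open ball of radius 3 r contains the closed cube of half-side 2 r that
    carries the cutoff. *)
Lemma derive_bump_bound : exists2 C : R, 0 <= C & forall p (r : R) i x, 0 < r ->
  `|'D_(e_ i) (cube_bump p r) x| <= C / r * \1_(ball p (3 * r)) x.
Proof.
have bi i : exists M : R, 0 <= M /\
    forall x, `|'D_(e_ i) (cube_bump (0 : space) 1) x| <= M.
  have cb := @C1_on_bump R setT 0 1 openT.
  have cD : continuous ('D_(e_ i) (cube_bump (0 : space) 1)).
    by move=> x; have [_ h] := @cb x I; exact: h.
  have b0 x : 2 < `|x| -> cube_bump (0 : space) 1 x = 0.
    by move=> x2; apply: cube_bump0; rewrite // mulr1 subr0.
  have [_ [M hM]] := tame_derive cD b0.
  exists M; split; last by move=> x; have [] := hM x.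
  by apply: le_trans (hM 0).1.
have [M hM] := choice bi.
exists (\sum_i M i) => [|p r i x r0]; first by apply: sumr_ge0 => i _; have [] := hM i.
rewrite indicE; case: (boolP (x \in _)) => [_|]; last first.
  rewrite notin_setE mx_norm_ball /ball_ /= => /negP; rewrite -leNgt => px.
  rewrite mulr0 (@derive_off_closed R _ _ (e_ i) x (@cube_closed _ p (2 * r)))
    ?normr0 //.
    by move=> y; exact: cube_bump_off.
  by move=> /= xp; move: px; rewrite distrC leNgt (le_lt_trans xp) // ltr_pM2r //; lra.
rewrite mulr1 derive_bump_scale ?gt_eqF // normrM mulrC.
rewrite normfV (gtr0_norm r0) ler_wpM2r ?invr_ge0 ?(ltW r0) //.
apply: le_trans (_ : M i <= _); first by have [] := hM i.
by rewrite (bigD1 i) //= lerDl sumr_ge0 // => j _; have [] := hM j.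
Qed.

Lemma derive_sub1 f x v : differentiable f x ->
  'D_v (fun y => 1 - f y) x = - 'D_v f x.
Proof.
move=> df; have := @deriveB R space R (cst (1 : R)) f x v.
rewrite derive_cst sub0r; apply; last exact: diff_derivable.
exact: derivable_cst.
Qed.

Section MultiCutoff.
Variable r : R.
Hypothesis r0 : 0 < r.

(** Vanishes on the cubes of half-side r centred at the points of ps, and is 1
    away from the cubes of half-side 2 r. *)
Definition away ps x : R := \prod_(p <- ps) (1 - cube_bump p r x).

Lemma C1_on_sub1 f : C1_on setT f -> C1_on setT (fun x => 1 - f x).
Proof.
move=> cf; have := C1_onD openT (@C1_on_cst _ setT 1)
  (C1_onM openT (@C1_on_cst _ setT (-1)) cf).
by congr C1_on; apply/funext => x; rewrite mulN1r.
Qed.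

Lemma C1_on_away ps : C1_on setT (away ps).
Proof.
apply: (C1_on_prod _ openT) => p; apply: C1_on_sub1.
exact: C1_on_bump openT.
Qed.

Lemma away_ge0 ps x : 0 <= away ps x.
Proof. by apply: prodr_ge0 => p _; rewrite subr_ge0 cube_bump_le1. Qed.

Lemma away_le1 ps x : away ps x <= 1.
Proof.
apply: prodr_ile1 => p _; rewrite subr_ge0 cube_bump_le1 /=.
by rewrite lerBlDr lerDl cube_bump_ge0.
Qed.

Lemma away0 ps p x : p \in ps -> `|x - p| <= r -> away ps x = 0.
Proof.
by move=> pps xp; rewrite /away (big_rem p) //= cube_bump1 // subrr mul0r.
Qed.

Lemma bump_le_indic p x : cube_bump p r x <= \1_(ball p (3 * r)) x.
Proof.
rewrite indicE; case: (boolP (x \in _)) => [_|]; first exact: cube_bump_le1.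
rewrite notin_setE mx_norm_ball /ball_ /= => /negP; rewrite -leNgt => px.
rewrite cube_bump0 // -(distrC p); apply: lt_le_trans px.
by rewrite ltr_pM2r //; lra.
Qed.

(** A product of factors in [0, 1] falls short of 1 by at most the sum of the
    shortfalls, and in the next lemma its derivative is at most the sum of the
    derivatives: only the number of cubes enters the estimates. *)
Lemma one_sub_away ps x :
  1 - away ps x <= \sum_(p <- ps) \1_(ball p (3 * r)) x.
Proof.
elim: ps => [|p qs IH]; first by rewrite /away !big_nil subrr.
rewrite /away !big_cons -/(away qs x).
have := bump_le_indic p x; have := away_le1 qs x; have := away_ge0 qs x.
have := cube_bump_ge0 p r x; have := cube_bump_le1 p r x.
move: IH; set a := away _ _; set b := cube_bump _ _ _; set S := \sum_(_ <- _) _.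
move=> *; nra.
Qed.

Lemma derive_away (C : R) : (forall p i x,
    `|'D_(e_ i) (cube_bump p r) x| <= C * \1_(ball p (3 * r)) x) ->
  forall ps i x,
  `|'D_(e_ i) (away ps) x| <= C * \sum_(p <- ps) \1_(ball p (3 * r)) x.
Proof.
move=> hC qs i x; elim: qs => [|p qs IH].
  rewrite big_nil mulr0 (_ : away [::] = cst 1) ?derive_cst ?normr0 //.
  by apply/funext => y; rewrite /away big_nil.
have -> : away (p :: qs) = (fun y => (1 - cube_bump p r y) * away qs y).
  by apply/funext => y; rewrite /away big_cons.
have cb := @C1_on_bump R setT p r openT.
have [db _] := @C1_on_sub1 _ cb x I; have [da _] := @C1_on_away qs x I.
have [dbb _] := @cb x I.
rewrite derive_mul // big_cons mulrDr.
have -> : 'D_(e_ i) (fun y => 1 - cube_bump p r y) x = - 'D_(e_ i) (cube_bump p r) x.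
  exact: derive_sub1.
rewrite addrC; apply: le_trans (ler_normD _ _) _; rewrite !normrM normrN.
have b01 : `|1 - cube_bump p r x| <= 1.
  rewrite ger0_norm ?subr_ge0 ?cube_bump_le1 //.
  by rewrite lerBlDr lerDl cube_bump_ge0.
have a01 : `|away qs x| <= 1 by rewrite ger0_norm ?away_ge0 ?away_le1.
apply: lerD.
  by apply: le_trans (hC p i x); rewrite ler_piMl.
by apply: le_trans IH; rewrite ler_piMl.
Qed.

End MultiCutoff.

Section TangentField.
Variables (V W : set space) (H : 'I_3 -> space -> R).
Hypothesis oV : open V.
Hypothesis bV : bounded_set V.
Hypothesis oW : open W.
Hypothesis VW : closure V `<=` W.
Hypothesis cH : forall i, C1_on W (H i).
Hypothesis tangentH : forall x nu, boundary V x -> outward_unit_normal V x nu ->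
  \sum_i H i x * nu 0 i = 0.
Local Notation flux := (int_div V H).

Lemma int_div_zero g : (forall x, V x -> g x = 0) -> flux g = 0.
Proof.
move=> g0; rewrite /int_div -[RHS](@vint0 R); congr vint; apply/funext => x.
rewrite patchE; case: ifPn => // /set_mem Vx; apply: big1 => i _.
transitivity ('D_(e_ i) (cst 0 : space -> R) x); last exact: derive_cst.
apply: near_eq_derive; near=> y; rewrite g0 ?mul0r //; near: y.
exact: open_nbhs_nbhs.
Unshelve. all: by end_near.
Qed.

(** Write g = g b + g (1 - b), where b is the cutoff at the first cube: the first
    part contributes nothing, and the second vanishes on that cube, hence is
    left with the cover by the other ones. *)
Lemma int_div_cover (l : seq (space * R)) :
  (forall u, u \in l -> 0 < u.2 /\ cutoff_vanishing V H u.1 u.2) ->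
  forall g, C1_on setT g -> (forall x, 0 <= g x) ->
  (forall x, V x -> (exists2 u, u \in l & `|x - u.1| <= u.2) \/ g x = 0) ->
  flux g = 0.
Proof.
elim: l => [_ g _ _ g0|[a r] l IH hl g cg g_ge0 g0].
  by apply: int_div_zero => x /g0[[]|].
have [/= r0 van] := hl (a, r) (mem_head _ _).
have cb := @C1_on_bump R setT a r openT.
have cgb := C1_onM openT cg cb.
have cgb' := C1_onM openT cg (C1_on_sub1 cb).
have -> : g = fun y => g y * cube_bump a r y + g y * (1 - cube_bump a r y).
  by apply/funext => y; ring.
rewrite (int_divD oV bV oW VW cH cgb cgb') (van g cg g_ge0) add0r.
apply: (IH _ _ cgb').
- by move=> u pl; apply: hl; rewrite inE pl orbT.
- by move=> x; rewrite mulr_ge0 // subr_ge0 cube_bump_le1.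
- move=> x Vx; have [[u]|->] := g0 x Vx; last by right; rewrite mul0r.
  rewrite inE => /orP[/eqP -> /= xa|pl xp]; last by left; exists u.
  by right; rewrite cube_bump1 // subrr mulr0.
Qed.

(** The field (1 - away) H is supported in the cubes, whose volumes are of order
    r^3, and its divergence is of order 1 + 1/r. *)
Lemma int_div_near_cubes : exists2 A, 0 <= A & forall (ps : seq space) r, 0 < r ->
  `|flux (fun x => 1 - away r ps x)| <= A * ((size ps)%:R * r ^+ 3 * (1 + r^-1)).
Proof.
have cVW : compact (closure V) by exact: bounded_closure_compact.
have b1 i : exists M, forall x, closure V x -> `|H i x| <= M.
  apply: bounded_on_compact => // x /VW Wx.
  exact: C1_on_continuous (cH i) Wx.
have b2 i : exists M, forall x, closure V x -> `|'D_(e_ i) (H i) x| <= M.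
  apply: bounded_on_compact => // x /VW Wx.
  by have [_ h] := cH i Wx; exact: h.
have [S1 hS1] := choice b1; have [S2 hS2] := choice b2.
have [C C0 hC] := derive_bump_bound.
pose S := \sum_i (`|S1 i| + `|S2 i|).
have S0 : 0 <= S by apply: sumr_ge0 => i _; rewrite addr_ge0.
(* 216 r^3 is the volume of a ball of radius 3 r *)
exists (S * (1 + C) * 216).
  by rewrite !mulr_ge0 // addr_ge0.
move=> ps r r0; set g := fun x => 1 - away r ps x.
have ca : C1_on setT (away r ps) by exact: C1_on_away.
have cg : C1_on setT g by exact: C1_on_sub1 ca.
have tg := tame_divg oV bV oW VW cH cg.
apply: le_trans (norm_vint_le tg) _.
pose B x := \sum_(p <- ps) \1_(ball p (3 * r)) x : R.
have r30 : 0 < 3 * r by rewrite mulr_gt0.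
have tB : tame B by apply: tame_sum => p; exact: tame_ball.
have B0 x : 0 <= B x by apply: sumr_ge0 => p _; rewrite indicE.
pose k := S * (1 + C) * (1 + r^-1).
apply: le_trans (_ : vint (fun x => k * B x) <= _).
  apply: le_vint; [exact: tame_norm|exact: tameZ|] => x.
  have k0 : 0 <= k by rewrite !mulr_ge0 // addr_ge0 // invr_ge0 ltW.
  rewrite patchE; case: ifPn => [/set_mem Vx|_]; last by rewrite normr0 mulr_ge0.
  have cVx := subset_closure Vx.
  rewrite /divg; apply: le_trans (ler_norm_sum _ _ _) _.
  rewrite /k /S -!mulrA mulr_suml; apply: ler_sum => i _.
  have [dg _] := @cg x I; have [dH _] := cH i (VW cVx).
  have [da _] := @ca x I.
  rewrite derive_mul // (derive_sub1 (e_ i) da) mulrN.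
  apply: le_trans (ler_normD _ _) _; rewrite normrN !normrM.
  have h1 : `|g x| <= B x.
    by rewrite ger0_norm ?subr_ge0 ?away_le1 //; exact: one_sub_away.
  have h2 : `|'D_(e_ i) (away r ps) x| <= C / r * B x.
    by apply: derive_away => // p j y; exact: hC.
  have h3 : `|H i x| <= `|S1 i| by apply: le_trans (ler_norm _); exact: hS1.
  have h4 : `|'D_(e_ i) (H i) x| <= `|S2 i| by apply: le_trans (ler_norm _); exact: hS2.
  have ri : 0 <= r^-1 by rewrite invr_ge0 ltW.
  have p1 := ler_pM (normr_ge0 _) (normr_ge0 _) h1 h4.
  have p2 := ler_pM (normr_ge0 _) (normr_ge0 _) h3 h2.
  apply: le_trans (lerD p1 p2) _; rewrite mulrDl [leRHS]addrC [B x * _]mulrC.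
  have K1 : 1 <= (1 + C) * (1 + r^-1) by nra.
  have K2 : C / r <= (1 + C) * (1 + r^-1) by nra.
  apply: lerD; apply: ler_wpM2l => //; last by rewrite mulrA ler_wpM2r.
  by rewrite mulrA ler_peMl.
rewrite vintZ // vint_sum; last by move=> p; exact: tame_ball.
under eq_bigr do rewrite vint_ball //.
rewrite big_const_seq count_predT iter_addr_0 -[X in _ * X]mulr_natl.
by rewrite le_eqVlt; apply/orP; left; apply/eqP; rewrite /k; ring.
Qed.

Section Arcs.
Variables (m : nat) (c : 'I_m -> R -> space).
Hypothesis cc : forall j, C1_curve (c j).
Hypothesis boundaryV : forall x, boundary V x ->
  (exists nu, outward_unit_normal V x nu) \/
  (exists j, (c j @` `[0, 1]) x).

(** [away r ps] vanishes on the balls of radius r about ps, which contain the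
    arcs. The rest of the closure of V is compact and consists of interior
    points and regular boundary points, so finitely many cubes of the local
    theorem cover it. *)
Lemma int_div_away (ps : seq space) r : 0 < r ->
  (forall j s, 0 <= s <= 1 -> exists2 p, p \in ps & `|c j s - p| < r) ->
  flux (away r ps) = 0.
Proof.
move=> r0 psc.
pose N := \bigcup_(p in [set` ps]) ball p r.
pose K := closure V `\` N.
have oN : open N by apply: bigcup_open => p _; exact: ball_open.
have cK : compact K.
  apply: (@compact_closedI _ (closure V) (~` N)); last exact: open_closedC.
  exact: bounded_closure_compact.
have /choice[rad hrad] : forall x, exists f : R,
    K x -> 0 < f /\ cutoff_vanishing V H x f.
  move=> x; have [[Vx nNx]|nK] := pselect (K x); last by exists 0.
  suff [f f0 hf] : exists2 f, 0 < f & cutoff_vanishing V H x f by exists f.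
  have [Vxx|nVx] := pselect (V x).
    exact: (cutoff_vanishing_interior oV VW cH Vxx).
  have bx : boundary V x by split => // /interior_subset.
  have [[nu hnu]|[j [s /= s01 cx]]] := boundaryV bx.
    exact: (cutoff_vanishing_boundary oV bV oW VW cH tangentH Vx hnu).
  exfalso; apply: nNx; move: s01; rewrite in_itv /= => s01.
  have [p pps cp] := psc j s s01; exists p => //.
  by rewrite mx_norm_ball /ball_ /= distrC -cx.
move: cK; rewrite compact_cover => /(_ space K (fun x => ball x (rad x))).
case=> [x Kx|x Kx|D DK KD].
- exact: ball_open.
- by exists x => //; apply: ballxx; have [] := hrad x Kx.
pose l := [seq (x, rad x) | x <- enum_fset D].
apply: (@int_div_cover l) => [u /mapP[x xD ->] /=|||x Vx].
- by apply: hrad; apply/set_mem/DK.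
- exact: C1_on_away.
- exact: away_ge0.
have [[p /= pps px]|nNx] := pselect (N x).
  right; apply: (away0 r0 pps); move: px.
  by rewrite mx_norm_ball /ball_ /= distrC => /ltW.
left; have [|y /= yD yx] := KD x; first by split => //; exact: subset_closure.
exists (y, rad y); first by apply/mapP; exists y.
by move: yx; rewrite mx_norm_ball /ball_ /= distrC => /ltW.
Qed.

(** With O(n) cubes of half-side M / n, the cutoff around the arcs costs
    n (M / n)^3 (1 + n / M), of order 1 / n. *)
Lemma int_div1_eq0 : flux (fun _ => 1) = 0.
Proof.
have [A A0 hA] := int_div_near_cubes.
have [M M0 hM] := arcs_cover cc.
pose T := A * (m%:R * 2 * M ^+ 3 * (1 + M^-1)).
have Mi : 0 < M^-1 by rewrite invr_gt0.
have small n : `|flux (fun _ => 1)| <= T / n.+1%:R.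
  have [ps sps psc] := hM n.
  have r0 : 0 < M / n.+1%:R by rewrite divr_gt0.
  have -> : (fun _ : space => 1 : R) =
    (fun x => away (M / n.+1%:R) ps x + (1 - away (M / n.+1%:R) ps x)).
    by apply/funext => x; rewrite addrC subrK.
  have ca : C1_on setT (away (M / n.+1%:R) ps) by exact: C1_on_away.
  rewrite (int_divD oV bV oW VW cH ca (C1_on_sub1 ca)) (int_div_away r0 psc) add0r.
  apply: le_trans (hA ps _ r0) _; rewrite /T -[leRHS]mulrA.
  apply: ler_wpM2l => //; rewrite sps.
  set N : R := n.+1%:R; have N1 : 1 <= N by rewrite ler1n.
  have N0 : 0 < N by exact: lt_le_trans N1.
  rewrite natrM invf_div.
  have h1 : n.+2%:R <= 2 * N by rewrite -natr1 -/N mulr_natl mulr2n lerD2l.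
  have h2 : 1 + N / M <= N * (1 + M^-1) by rewrite mulrDr mulr1 lerD2r.
  have -> : m%:R * 2 * M ^+ 3 * (1 + M^-1) / N =
      m%:R * (2 * N) * (M / N) ^+ 3 * (N * (1 + M^-1)).
    by field; rewrite !gt_eqF.
  have h3 : 0 <= (M / N) ^+ 3 by rewrite exprn_ge0 // divr_ge0 // ltW.
  have h4 : 0 <= 1 + N / M by rewrite addr_ge0 // divr_ge0 // ltW.
  apply: ler_pM => //; first by rewrite mulr_ge0 // mulr_ge0.
  by rewrite ler_wpM2r // ler_wpM2l.
apply/eqP; rewrite -normr_le0; apply/ler_addgt0Pr => e e0; rewrite add0r.
apply: le_trans (small (Num.truncn (T / e))) _.
rewrite ler_pdivrMr // mulrC -ler_pdivrMr //.
exact: ltW (truncnS_gt _).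
Qed.

(** The divergence theorem for fields that have no flux through the boundary.
*)
Lemma integral_div_tangent :
  vint ((fun x => \sum_i 'D_(e_ i) (H i) x) \_ V) = 0.
Proof.
transitivity (flux (fun _ => 1)); last exact: int_div1_eq0.
rewrite /int_div; congr vint; apply/funext => x; rewrite !patchE.
case: ifPn => // _; apply: eq_bigr => i _; congr ('D_(_) _ x).
by apply/funext => y; rewrite mul1r.
Qed.

End Arcs.

End TangentField.

End DivergenceTheorem.

(** * The entropy balance *)

Section Vector.
Variable R : realType.
Local Notation space := 'rV[R]_3.
Local Notation e_ i := (basis_vec R i).
Local Notation volume := (@volume R).
Local Notation line := (measurableTypeR R).
Local Notation coords := (@of_coords R : line * line * line -> space).
Implicit Types (x : space) (G : space -> space).

Lemma restrict_coords (f : space -> R) (V : set space) :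
  EFin \o ((f \_ V) \o coords) =
  ((fun p => (f (coords p))%:E) \_ (coords @^-1` V))%E.
Proof.
apply/funext => p /=; rewrite !patchE.
rewrite (_ : (p \in _) = (of_coords p \in V)); first by case: ifPn.
by apply/idP/idP; rewrite !inE.
Qed.

Lemma tame_volume_integrable (f : space -> R) (V : set space) :
  open V -> tame (f \_ V) -> volume_integrable V f.
Proof.
move=> oV /tame_integrable; rewrite restrict_coords => h.
exact: ((integrable_mkcond _ (measurable_open_coords oV)).2 h).
Qed.

Lemma volume_integralE (f : space -> R) (V : set space) :
  open V -> tame (f \_ V) -> volume_integral V f = (vint (f \_ V))%:E.
Proof.
move=> oV tf; rewrite /vint /Rintegral fineK.
  transitivity (\int[volume]_p ((EFin \o ((f \_ V) \o coords)) p))%E => //.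
  by rewrite restrict_coords -integral_mkcond.
exact: integrable_fin_num (tame_integrable tf).
Qed.

Lemma jacobian_coord G x i j : differentiable G x ->
  'J G x i j = ('D_(e_ i) G x) 0 j.
Proof. by move=> dG; rewrite deriveE // /jacobian mxE. Qed.

Lemma divergenceE G x : differentiable G x ->
  divergence G x = \sum_i 'D_(e_ i) (fun y => G y 0 i) x.
Proof.
move=> dG; apply: eq_bigr => i _; rewrite jacobian_coord //.
by rewrite derive_mx ?mxE //; exact: diff_derivable.
Qed.

Lemma differentiable_coords G x :
  (forall i, differentiable (fun y => G y 0 i) x) -> differentiable G x.
Proof.
move=> dG.
have -> : G = \sum_(i < 3) (fun y => G y 0 i *: e_ i).
  apply/funext => y; rewrite fct_sumE; apply/rowP => j.
  rewrite summxE (bigD1 j) //= !mxE !eqxx mulr1 big1 ?addr0 // => k kj.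
  by rewrite !mxE eqxx eq_sym (negbTE kj) mulr0.
by apply: differentiable_sum => i; exact: differentiableZl.
Qed.

(** The Cauchy-Schwarz inequality for the diagonal of A. *)
Lemma contraction_ge (A : 'M[R]_3) :
  (\tr A) ^+ 2 <= 3 * Defs.contraction A A.
Proof.
apply: le_trans (_ : 3 * \sum_i A i i ^+ 2 <= _).
  rewrite /mxtrace !big_ord_recl !big_ord0 !addr0.
  set a := A _ _; set b := A _ _; set c := A _ _.
  have := sqr_ge0 (a - b); have := sqr_ge0 (b - c); have := sqr_ge0 (a - c).
  nra.
rewrite ler_pM2l //; apply: ler_sum => i _; rewrite (bigD1 i) //= expr2 lerDl.
by apply: sumr_ge0 => j _; rewrite -expr2 sqr_ge0.
Qed.

End Vector.

Section Dissipation.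
Variables (R : realType) (F : two_phase_flow R) (t : R).
Local Notation space := 'rV[R]_3.
Implicit Types (x : space) (k : 'I_2).

Lemma trace_strain x : \tr (strain_rate F t x) = divergence (velocity F t) x.
Proof.
rewrite /strain_rate /divergence mxtraceZ mxtraceD mxtrace_tr; lra.
Qed.

Lemma contractionDl (A B C : 'M[R]_3) :
  Defs.contraction (A + B) C = Defs.contraction A C + Defs.contraction B C.
Proof.
rewrite /Defs.contraction -big_split; apply: eq_bigr => i _ /=.
by rewrite -big_split; apply: eq_bigr => j _ /=; rewrite mxE mulrDl.
Qed.

Lemma contractionZl (a : R) (A B : 'M[R]_3) :
  Defs.contraction (a *: A) B = a * Defs.contraction A B.
Proof.
rewrite /Defs.contraction mulr_sumr; apply: eq_bigr => i _.
by rewrite mulr_sumr; apply: eq_bigr => j _; rewrite mxE mulrA.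
Qed.

Lemma contraction_scalar (a : R) (A : 'M[R]_3) :
  Defs.contraction a%:M A = a * \tr A.
Proof.
rewrite /Defs.contraction /mxtrace mulr_sumr; apply: eq_bigr => i _.
rewrite (bigD1 i) //= mxE eqxx mulr1n big1 ?addr0 // => j ji.
by rewrite mxE eq_sym (negbTE ji) mul0r.
Qed.

(** With D the strain rate, tr D = div u turns tau : D into
    2/3 mu (3 D : D - (tr D)^2) + mu_b (div u)^2. *)
Lemma viscous_power_ge0 k x : 0 <= alpha F k t x ->
  0 < shear_visc F k t x -> 0 < bulk_visc F k t x -> 0 <= viscous_power F k t x.
Proof.
move=> a0 s0 b0; rewrite /viscous_power mulr_ge0 // /viscous_stress.
rewrite contractionDl contractionZl contraction_scalar trace_strain.
have := contraction_ge (strain_rate F t x); rewrite trace_strain.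
set d := divergence _ _; set c := Defs.contraction _ _ => dc.
rewrite (_ : _ + _ = 2 / 3 * shear_visc F k t x * (3 * c - d ^+ 2)
  + bulk_visc F k t x * d ^+ 2); last by field.
by rewrite addr_ge0 // mulr_ge0 ?sqr_ge0 ?subr_ge0 ?(ltW b0) // mulr_ge0 ?ltW.
Qed.

(** The sum is varsigma (T_1 - T_2)^2 / (T_1 T_2). *)
Lemma heat_exchange_ge0 x : 0 <= relax_rate F t x ->
  (forall k, 0 < temp F k t x) ->
  0 <= \sum_k heat_exchange F k t x / temp F k t x.
Proof.
move=> r0 T0; rewrite !big_ord_recl big_ord0 addr0 /heat_exchange.
have -> : rev_ord (ord0 : 'I_2) = lift ord0 ord0 by exact: val_inj.
have -> : rev_ord (lift ord0 ord0 : 'I_2) = ord0 by exact: val_inj.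
have := T0 ord0; have := T0 (lift ord0 ord0).
set a := temp F ord0 t x; set b := temp F _ t x => b0 a0.
rewrite (_ : _ + _ = relax_rate F t x * ((a - b) ^+ 2 / (a * b))).
  by rewrite mulr_ge0 // divr_ge0 ?sqr_ge0 // mulr_ge0 // ltW.
by field; rewrite !gt_eqF.
Qed.

End Dissipation.

Section Balance.
Variables (R : realType) (F : two_phase_flow R).
Local Notation space := 'rV[R]_3.
Local Notation e_ i := (basis_vec R i).
Variables (V W : set space) (t : R).
Hypothesis openV : open V.
Hypothesis boundedV : bounded_set V.
Hypothesis openW : open W.
Hypothesis clVW : closure V `<=` W.
Hypothesis smoothF : smooth_flow F W t.
Hypothesis admissibleF : admissible_flow F (closure V) t.
Implicit Types (x : space) (k : 'I_2).
Local Notation T := (temp F).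

Let kappa k x : R := alpha F k t x * conductivity F k t x.

(** The temperatures are positive on the closure of V only; this is an open
    neighbourhood of it in which one can divide by them. *)
Let Wpos : set space := W `&` [set x | forall k, 0 < T k t x].

(** Minus the entropy flux of phase k, which is - kappa grad T / T. *)
Let Hs k (i : 'I_3) x : R := kappa k x * 'D_(e_ i) (T k t) x * (T k t x)^-1.

(** What remains of the source once the divergences of the fields Hs are taken
    out of it. *)
Let production x : R :=
  \sum_k ((viscous_power F k t x + heat_exchange F k t x + external_heat F k t x)
          / T k t x
    + \sum_i kappa k x * 'D_(e_ i) (T k t) x ^+ 2 / T k t x ^+ 2).

Lemma Wpos_open : open Wpos.
Proof.
rewrite openE => x [Wx Tx]; apply: filterI; first exact: open_nbhs_nbhs.
have near_pos k : \forall y \near x, 0 < T k t y.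
  have [cT _] := C2_temp smoothF k.
  have cTx : T k t y @[y --> x] --> T k t x by exact: C1_on_continuous cT Wx.
  by apply: (cvgr_gt _ cTx); exact: Tx.
exact: (@filter_forall _ _ (fun k y => 0 < T k t y) (nbhs x) _ near_pos).
Qed.

Lemma closure_Wpos : closure V `<=` Wpos.
Proof.
move=> x Vx; split; first exact: clVW.
by move=> k; exact: temp_gt0 admissibleF k x Vx.
Qed.

Let Wpos_W : Wpos `<=` W. Proof. by move=> x []. Qed.

Let T0 k x : Wpos x -> T k t x != 0.
Proof. by move=> [_ /(_ k)]; rewrite lt0r => /andP[]. Qed.

Lemma C1_temp k : C1_on Wpos (T k t).
Proof. by have [c _] := C2_temp smoothF k; exact: C1_on_sub Wpos_W c. Qed.

Lemma C1_kappa_grad k i : C1_on Wpos (fun x => kappa k x * 'D_(e_ i) (T k t) x).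
Proof.
have [_ c] := C2_temp smoothF k.
apply: (C1_onM Wpos_open _ (C1_on_sub Wpos_W (c i))).
exact: (C1_onM Wpos_open (C1_on_sub Wpos_W (C1_alpha smoothF k))
  (C1_on_sub Wpos_W (C1_conductivity smoothF k))).
Qed.

Lemma C1_Hs k i : C1_on Wpos (Hs k i).
Proof.
exact: (C1_onM Wpos_open (C1_kappa_grad k i)
  (C1_onV Wpos_open (C1_temp k) (T0 k))).
Qed.

Lemma conductionE k x : Wpos x -> conduction F k t x =
  \sum_i 'D_(e_ i) (fun y => kappa k y * 'D_(e_ i) (T k t) y) x.
Proof.
move=> Wx.
have cE i : (fun y => conduction_vec F k t y 0 i) =
            (fun y => kappa k y * 'D_(e_ i) (T k t) y).
  by apply/funext => y; rewrite !mxE.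
rewrite /conduction divergenceE; first by apply: eq_bigr => i _; rewrite cE.
by apply: differentiable_coords => i; rewrite cE; have [] := C1_kappa_grad k i Wx.
Qed.

(** The product rule for kappa grad T times 1 / T: the second sum is the entropy
    produced by Fourier's law. *)
Lemma conduction_div k x : Wpos x -> conduction F k t x / T k t x =
  \sum_i 'D_(e_ i) (Hs k i) x +
  \sum_i kappa k x * 'D_(e_ i) (T k t) x ^+ 2 / T k t x ^+ 2.
Proof.
move=> Wx; rewrite conductionE // mulr_suml -big_split /=.
apply: eq_bigr => i _.
have [dk _] := C1_kappa_grad k i Wx; have [dT _] := C1_temp k Wx.
have Tx := T0 k Wx.
rewrite /Hs (derive_mul (e_ i) dk (differentiableV dT Tx)).
rewrite (deriveV Tx (@diff_derivable _ _ _ _ _ (e_ i) dT)) -[_ *: _]/(_ * _).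
by field.
Qed.

Let source x := \sum_k (viscous_power F k t x + heat_exchange F k t x
            + conduction F k t x + external_heat F k t x) / T k t x.

Lemma sourceE x : Wpos x ->
  source x = production x + \sum_k \sum_i 'D_(e_ i) (Hs k i) x.
Proof.
move=> Wx; rewrite /source /production -big_split /=; apply: eq_bigr => k _.
rewrite (_ : _ / _ = (viscous_power F k t x + heat_exchange F k t x
  + external_heat F k t x) / T k t x + conduction F k t x / T k t x); last by ring.
by rewrite conduction_div // [X in _ + X]addrC addrA.
Qed.

Lemma production_ge0 x : closure V x -> 0 <= production x.
Proof.
move=> Vx; have TP k := temp_gt0 admissibleF k Vx.
have -> : production x = \sum_k heat_exchange F k t x / T k t x +
    \sum_k ((viscous_power F k t x + external_heat F k t x) / T k t x +
    \sum_i kappa k x * 'D_(e_ i) (T k t) x ^+ 2 / T k t x ^+ 2).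
  by rewrite -big_split /=; apply: eq_bigr => k _; ring.
apply: addr_ge0.
  by apply: heat_exchange_ge0 => //; exact: ltW (relax_rate_gt0 admissibleF Vx).
apply: sumr_ge0 => k _; have a0 := alpha_ge0 admissibleF k Vx.
apply: addr_ge0.
  rewrite divr_ge0 ?(ltW (TP k)) // addr_ge0 //.
    apply: (viscous_power_ge0 a0); first exact: shear_visc_gt0 admissibleF k x Vx.
    exact: bulk_visc_gt0 admissibleF k x Vx.
  exact: mulr_ge0 a0 (heat_intensity_ge0 admissibleF k Vx).
apply: sumr_ge0 => i _; rewrite divr_ge0 ?sqr_ge0 // mulr_ge0 ?sqr_ge0 //.
exact: mulr_ge0 a0 (conductivity_ge0 admissibleF k Vx).
Qed.

Lemma continuous_jacobian_velocity i j x : W x ->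
  {for x, continuous (fun y => 'J (velocity F t) y i j)}.
Proof.
move=> Wx; have cv := C1_velocity smoothF; have [dv cD] := cv x Wx.
apply: (@continuous_for_near _ _ (fun y => ('D_(e_ i) (velocity F t) y) 0 j)).
  near=> y; rewrite jacobian_coord //.
  by have [] := cv y; first by near: y; exact: open_nbhs_nbhs.
apply: (continuous_comp (g := fun M : 'rV[R]_3 => M 0 j)); first exact: cD.
exact: coord_continuous.
Unshelve. all: by end_near.
Qed.

Lemma continuous_divergence_velocity x : W x ->
  {for x, continuous (divergence (velocity F t))}.
Proof.
by move=> Wx; apply: continuous_sum => i; exact: continuous_jacobian_velocity.
Qed.

Lemma continuous_strain i j x : W x ->
  {for x, continuous (fun y => strain_rate F t y i j)}.
Proof.
move=> Wx.
rewrite (_ : (fun y => _) = fun y => 2^-1 *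
  ('J (velocity F t) y i j + 'J (velocity F t) y j i)); last first.
  by apply/funext => y; rewrite !mxE.
apply: continuous_mul; first exact: continuous_cst.
by apply: continuous_add; exact: continuous_jacobian_velocity.
Qed.

Lemma continuous_stress k i j x : W x ->
  {for x, continuous (fun y => viscous_stress F k t y i j)}.
Proof.
move=> Wx.
rewrite (_ : (fun y => _) = fun y =>
  2 * shear_visc F k t y * strain_rate F t y i j +
  (bulk_visc F k t y + - (2 / 3) * shear_visc F k t y)
     * divergence (velocity F t) y * (i == j)%:R); last first.
  by apply/funext => y; rewrite !mxE mulNr mulr_natr.
have cs : {for x, continuous (shear_visc F k t)}.
  exact: (cont_shear_visc smoothF).
have cb : {for x, continuous (bulk_visc F k t)} by exact: (cont_bulk_visc smoothF).
apply: continuous_add; apply: continuous_mul.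
- by apply: continuous_mul => //; exact: continuous_cst.
- exact: continuous_strain.
- apply: continuous_mul; last exact: continuous_divergence_velocity.
  apply: continuous_add => //; apply: continuous_mul => //.
  exact: continuous_cst.
- exact: continuous_cst.
Qed.

Lemma continuous_production x : Wpos x -> {for x, continuous production}.
Proof.
move=> Wpx; have Wx := Wpos_W Wpx.
have cT k := C1_on_continuous (C1_temp k) Wpx.
have ca k := C1_on_continuous (C1_alpha smoothF k) Wx.
have ck k := C1_on_continuous (C1_conductivity smoothF k) Wx.
have ciT k : {for x, continuous (fun y => (T k t y)^-1)}.
  by apply: continuous_inv; [exact: T0|exact: cT].
apply: continuous_sum => k; apply: continuous_add.
  apply: continuous_mul (ciT k); apply: continuous_add; first apply: continuous_add.
  - apply: continuous_mul (ca k) _.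
    apply: continuous_sum => i; apply: continuous_sum => j.
    apply: continuous_mul; first exact: continuous_stress.
    exact: continuous_strain.
  - apply: continuous_mul; first exact: cont_relax_rate smoothF x Wx.
    by apply: continuous_add; [exact: cT|apply: continuous_opp; exact: cT].
  - have ch : {for x, continuous (heat_intensity F k t)}.
      exact: (cont_heat_intensity smoothF).
    exact: continuous_mul (ca k) ch.
apply: continuous_sum => i; apply: continuous_mul.
  apply: continuous_mul; first exact: continuous_mul (ca k) (ck k).
  have [_ cD] := C1_temp k Wpx.
  exact: continuous_mul (cD i) (cD i).
apply: continuous_inv; first by rewrite expf_neq0 // T0.
exact: continuous_mul (cT k) (cT k).
Qed.

Lemma tame_production : tame (production \_ V).
Proof.
by apply: tame_patch => // x /closure_Wpos; exact: continuous_production.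
Qed.

Lemma tame_div_Hs k : tame ((fun x => \sum_i 'D_(e_ i) (Hs k i) x) \_ V).
Proof.
apply: tame_patch => // x /closure_Wpos Wx; apply: continuous_sum => i.
by have [_ h] := C1_Hs k i Wx; exact: h.
Qed.

Lemma source_patch : source \_ V = (fun x => (production \_ V) x +
  \sum_k ((fun x => \sum_i 'D_(e_ i) (Hs k i) x) \_ V) x).
Proof.
apply/funext => x; under [in RHS]eq_bigr do rewrite patchE.
rewrite !patchE; case: ifPn => [/set_mem Vx|_].
  by rewrite sourceE //; exact: closure_Wpos (subset_closure Vx).
by rewrite big1 ?addr0.
Qed.

Lemma tame_source : tame (source \_ V).
Proof.
rewrite source_patch; apply: tameD; first exact: tame_production.
by apply: tame_sum => k; exact: tame_div_Hs.
Qed.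

Hypothesis piecewise_smoothV : piecewise_smooth_boundary V.
Hypothesis adiabaticF : adiabatic_boundary F V t.

Lemma Hs_tangent k x nu : boundary V x -> outward_unit_normal V x nu ->
  \sum_i Hs k i x * nu 0 i = 0.
Proof.
move=> bx nux; have := adiabaticF k bx nux.
rewrite /dot => h.
have -> : \sum_i Hs k i x * nu 0 i =
    (T k t x)^-1 * \sum_i conduction_vec F k t x 0 i * nu 0 i.
  rewrite mulr_sumr; apply: eq_bigr => i _.
  by rewrite /Hs !mxE /kappa; ring.
by rewrite h mulr0.
Qed.

(** The divergences of the fields Hs integrate to zero, which leaves
    [production]. *)
Lemma vint_source_ge0 : 0 <= vint (source \_ V).
Proof.
have [m [c [cc bV]]] := piecewise_smoothV.
rewrite source_patch vintD; last 2 first.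
- exact: tame_production.
- by apply: tame_sum => k; exact: tame_div_Hs.
rewrite vint_sum; last by move=> k; exact: tame_div_Hs.
rewrite big1 => [|k _].
  rewrite addr0; apply: Rintegral_ge0 => p _; rewrite patchE.
  case: ifPn => // /set_mem Vx; exact: production_ge0 (subset_closure Vx).
exact: (integral_div_tangent openV boundedV Wpos_open closure_Wpos
  (C1_Hs k) (@Hs_tangent k) cc bV).
Qed.

End Balance.

Theorem proposition1 (R : realType) (F : two_phase_flow R)
    (V W : set 'rV[R]_3) (t : R)
    (openV : open V) (boundedV : bounded_set V)
    (piecewise_smoothV : piecewise_smooth_boundary V)
    (openW : open W) (clVW : closure V `<=` W)
    (smoothF : smooth_flow F W t)
    (admissibleF : admissible_flow F (closure V) t)
    (balanceF : forall x, V x -> entropy_balance F t x)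
    (adiabaticF : adiabatic_boundary F V t) :
  let source := fun x : 'rV[R]_3 =>
    \sum_k (viscous_power F k t x + heat_exchange F k t x
            + conduction F k t x + external_heat F k t x) / temp F k t x in
  [/\ volume_integrable V (entropy_production F t),
      volume_integrable V source,
      volume_integral V (entropy_production F t) = volume_integral V source &
      (0 <= volume_integral V source)%E].
Proof.
move=> source.
have ts : tame (source \_ V).
  exact: (tame_source openV boundedV openW clVW smoothF admissibleF).
have es : entropy_production F t \_ V = source \_ V.
  apply/funext => x; rewrite !patchE; case: ifPn => // /set_mem Vx.
  rewrite (balanceF x Vx) /source -big_split /=; apply: eq_bigr => k _.
  by ring.
have te : tame (entropy_production F t \_ V) by rewrite es.
split.
- exact: tame_volume_integrable.
- exact: tame_volume_integrable.
- by rewrite !volume_integralE // es.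
- rewrite volume_integralE // lee_fin.
  exact: (vint_source_ge0 openV boundedV openW clVW smoothF admissibleF
    piecewise_smoothV adiabaticF).
Qed.
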